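(* Let $\epsilon=\epsilon(n)>0$ be such that $\epsilon^3 n \rightarrow \infty$ and $\epsilon=o(1)$, and let $p=\frac{1+\epsilon}{n}$. Then with high probability \[ \mathrm{excess}\left(L_1\left(G(n,n,p)\right)\right) = (1+o(1)) \frac{4}{3}\epsilon^3 n. \]
   Context: $G(n,n,p)$ is the binomial random bipartite graph with two partition classes, each of size $n$, in which each edge between the classes is included independently with probability $p$. $L_1(G)$ denotes the largest component of a graph $G$. The excess of a connected graph is its number of edges minus its number of vertices. With high probability means with probability tending to one as $n\to\infty$; all asymptotics are as $n\to\infty$. *)

(* Defs.v *)
From HB Require Import structures.
From mathcomp Require Import all_boot all_order all_algebra.

Set Implicit Arguments.
Unset Strict Implicit.
Unset Printing Implicit Defensive.

Import Order.TTheory GRing.Theory Num.Theory.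

(* A finite simple graph is a symmetric irreflexive relation [e] on a finite
   type of vertices; a component is represented by its set of vertices. *)
Section Graph.
Variables (V : finType) (e : rel V).

Definition components : {set {set V}} :=
  equivalence_partition (connect e) [set: V].

(* All components with the maximum number of vertices: there may be ties. *)
Definition largest_components : {set {set V}} :=
  [set C in components | [forall D in components, #|D| <= #|C|]].

Definition edges_in (C : {set V}) : {set {set V}} :=
  [set [set x; y] | x in C, y in C & e x y].

Definition excess (C : {set V}) : int :=
  ((#|edges_in C|)%:Z - (#|C|)%:Z)%R.

End Graph.

(* A bipartite graph with classes [inl 'I_n] and [inr 'I_n] is given by the set
   of pairs [(i, j)] such that [inl i] and [inr j] are joined. *)
Definition bipgraph (n : nat) : finType := {set 'I_n * 'I_n}.

Definition bip_adj (n : nat) (G : bipgraph n) : rel ('I_n + 'I_n) :=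
  fun u v => match u, v with
  | inl i, inr j | inr j, inl i => (i, j) \in G
  | _, _ => false
  end.

Lemma bip_adj_sym (n : nat) (G : bipgraph n) : symmetric (bip_adj G).
Proof. by case=> [i|i] [j|j]. Qed.

Lemma bip_adj_irr (n : nat) (G : bipgraph n) : irreflexive (bip_adj G).
Proof. by case. Qed.

Section BinomialBipartite.
Local Open Scope ring_scope.
Variables (R : numDomainType) (n : nat) (p : R).

(* The mass function of G(n,n,p); it is a probability when [0 <= p <= 1]. *)
Definition Gnnp_mass (G : bipgraph n) : R :=
  \prod_(ij : 'I_n * 'I_n) (if ij \in G then p else 1 - p).

Definition Gnnp_prob (A : pred (bipgraph n)) : R :=
  \sum_(G : bipgraph n | A G) Gnnp_mass G.

End BinomialBipartite.

(* Main.v *)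
(* Explore G one vertex at a time.  Processing a vertex reveals its pairs with the
   unprocessed vertices of the other class: tree pairs lead to undiscovered vertices,
   surplus pairs to active ones.  A component is explored during a maximal run of
   rounds between two idle states, so its size is the length of that run and its
   excess is the number of surplus edges found minus 1.

   Each count of revealed edges minus p times the number of revealed pairs is a
   martingale, controlled by Kolmogorov's maximal inequality.  Write N = n and e for
   epsilon.  Up to o(e^2 N), after k rounds both classes have about k/2 processed
   vertices and the number of active vertices is (starts so far) + e k - k^2 / (4 N).
   Hence one excursion covers essentially [0, 4 e N], and the sum of the active
   counts faced by the processed vertices, which is the number of surplus pairs
   revealed in it, is (4/3) e^3 N^2.  After 4 e N the drift at round k is at most
   - c k / N; a martingale with weights of order e N / k then excludes any further
   long excursion.  All error probabilities are O(1 / (e^3 N)). *)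
Require Import Defs.
From mathcomp Require Import all_boot all_order all_algebra.
From mathcomp Require Import all_classical all_reals all_analysis.
From mathcomp Require Import ring lra zify.
From mathcomp Require Import finset.

Set Implicit Arguments.
Unset Strict Implicit.
Unset Printing Implicit Defensive.

Import Order.TTheory GRing.Theory Num.Theory.
Import numFieldNormedType.Exports.

(** * An adaptive Kolmogorov inequality *)

(** The hard point is to exclude a second long excursion when only e^3 N is known to be large. Over
    all 2 N rounds the unweighted noise is of order sqrt N, while the tolerance on active counts is
    a small multiple of e^2 N; comparing them would need e^4 N to be large. Damped weights lower the
    total variance to O(e N), and sqrt (e N) is small against e^2 N exactly when e^3 N is large. The
    unweighted noise is compared only with e N, to keep the two classes balanced at late times.

    A second obstacle is that the number of starts enters every estimate before it is known. It is
    carried with a small coefficient and bounded afterwards: a start needs an empty active set, and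
    then the formula for the active count limits the starts made so far.

    The constant comes from integrating e z - z^2 / (2 N), the active count of one class when z
    vertices of the other are processed, over [0, 2 e N]. This gives (2/3) e^3 N^2 for each class;
    the factor p, close to 1 / N, turns the sum into (4/3) e^3 N. *)

Section BernoulliMean.
Local Open Scope ring_scope.
Variables (R : realFieldType) (T : finType) (p : R).
Implicit Types (G U : {set T}) (f : {set T} -> R).

Definition bern_mass G : R := \prod_q (if q \in G then p else 1 - p).
Definition bern_mean f : R := \sum_G bern_mass G * f G.

Lemma bern_mean_split (q : T) f :
  bern_mean f = \sum_(G : {set T} | q \notin G)
    (\prod_(r | r != q) (if r \in G then p else 1 - p)) *
    (p * f (q |: G) + (1 - p) * f G).
Proof.
rewrite /bern_mean (bigID (fun G : {set T} => q \in G)) /=.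
rewrite (reindex_onto (fun G : {set T} => q |: G) (fun G : {set T} => G :\ q)) /=; last first.
  by move=> G qG; rewrite finset.setD1K.
rewrite (eq_bigl (fun G : {set T} => q \notin G)); last first.
  move=> G; rewrite finset.setU11 /=; apply/eqP/idP => [<-|qG].
    by rewrite !inE eqxx.
  by rewrite finset.setU1K.
rewrite -big_split /=; apply: eq_bigr => G qG.
rewrite /bern_mass (bigD1 q) //= finset.setU11 [X in _ + X * _](bigD1 q) //= (negPf qG).
have -> : \prod_(i | i != q) (if i \in q |: G then p else 1 - p) =
          \prod_(i | i != q) (if i \in G then p else 1 - p).
  by apply: eq_bigr => i iq; rewrite !inE (negPf iq).
ring.
Qed.

Definition ignores (q : T) f := forall G : {set T}, f (q |: G) = f (G :\ q).

Lemma ignoresP q f G : ignores q f -> f (q |: G) = f G.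
Proof.
move=> fq; case: (boolP (q \in G)) => qG.
  by congr f; apply/finset.setUidPr; rewrite sub1set.
by rewrite fq; congr f; apply/finset.setDidPl; rewrite disjoint_sym disjoints1.
Qed.

(** The bit of [q] is a separate argument of [F]: once it is fixed, what remains depends on the
    other coordinates only, so independence factors it out. *)
Lemma bern_mean_reveal (q : T) (F : bool -> {set T} -> R) :
  (forall b, ignores q (F b)) ->
  bern_mean (fun G => F (q \in G) G) =
  p * bern_mean (F true) + (1 - p) * bern_mean (F false).
Proof.
move=> Fq; rewrite !(bern_mean_split q) !mulr_sumr -big_split /=.
apply: eq_bigr => G qG; rewrite finset.setU11 (negPf qG) !(ignoresP _ (Fq _)); ring.
Qed.

Lemma bern_mean1 : bern_mean (fun=> 1) = 1.
Proof.
rewrite /bern_mean /bern_mass.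
transitivity (\prod_(q : T) \sum_(b : bool) (if b then p else 1 - p)); last first.
  by rewrite big1 // => q _; rewrite big_bool /=; ring.
rewrite bigA_distr_bigA /=.
rewrite (reindex (fun G : {set T} => [ffun q => q \in G])) /=; last first.
  exists (fun f : {ffun T -> bool} => [set q | f q]) => [G _|f _].
    by apply/setP => q; rewrite inE ffunE.
  by apply/ffunP => q; rewrite ffunE inE.
by apply: eq_bigr => G _; rewrite mulr1; apply: eq_bigr => q _; rewrite ffunE.
Qed.

End BernoulliMean.

Section AdaptiveKolmogorov.
Local Open Scope ring_scope.
Variables (R : realFieldType) (T : finType) (p : R).
Hypotheses (p_ge0 : 0 <= p) (p_le1 : p <= 1).
Implicit Types (G U : {set T}).

Lemma bern_mass_ge0 G : 0 <= bern_mass p G.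
Proof. by apply: prodr_ge0 => q _; case: ifP; rewrite ?subr_ge0. Qed.

Lemma bern_mean_le (f g : {set T} -> R) :
  (forall G, f G <= g G) -> bern_mean p f <= bern_mean p g.
Proof.
by move=> fg; apply: ler_sum => G _; apply: ler_wpM2l (fg G); apply: bern_mass_ge0.
Qed.

Lemma eq_bern_mean (f g : {set T} -> R) : f =1 g -> bern_mean p f = bern_mean p g.
Proof. by move=> fg; apply: eq_bigr => G _; rewrite fg. Qed.

(** One round, revealed pair by pair: [U] collects the pairs found present and [s] is the running
    sum. Each pair adds a centred increment to [s], hence only its variance to the mean of
    [s ^+ 2]. *)
Lemma bern_mean_reveal_seq (ws : seq T) (w : T -> R) (beta c : R)
    (F : {set T} -> R -> {set T} -> R) :
  0 <= c -> uniq ws ->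
  (forall U s q, q \in ws -> ignores q (F U s)) ->
  (forall U s, bern_mean p (F U s) <= (s ^+ 2 + beta) * c) ->
  forall U s,
  bern_mean p (fun G => F (U :|: [set q in ws | q \in G])
                 (s + \sum_(q <- ws) w q * ((q \in G)%:R - p)) G)
  <= (s ^+ 2 + (beta + p * \sum_(q <- ws) w q ^+ 2)) * c.
Proof.
move=> starts_total_ge0; elim: ws => [|q ws IH] /= ws_uniq Fign Fle U s.
  rewrite big_nil mulr0 addr0.
  rewrite (eq_bern_mean (g := F U s)) // => G.
  rewrite big_nil addr0; congr (F _ _ _); apply/setP => r.
  by rewrite !inE orbF.
have /andP[q_ws ws_u] := ws_uniq.
pose H b G := F ((if b then q |: U else U) :|: [set r in ws | r \in G])
  (s + w q * (b%:R - p) + \sum_(r <- ws) w r * ((r \in G)%:R - p)) G.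
rewrite (eq_bern_mean (g := fun G => H (q \in G) G)); last first.
  move=> G; rewrite /H big_cons addrA; congr (F _ _ _).
  apply/setP => r; rewrite !inE; case: (boolP (q \in G)) => qG; rewrite ?inE.
    by case: (eqVneq r q) => [->|_] //=; rewrite qG orbT.
  by case: (eqVneq r q) => [->|_] //=; rewrite (negPf qG) (negPf q_ws).
rewrite bern_mean_reveal; last first.
  move=> b G; rewrite /H Fign ?mem_head //; congr (F _ _ _).
    congr (_ :|: _); apply/setP => r; rewrite !inE.
    by case: (eqVneq r q) => [->|_] //=; rewrite (negPf q_ws).
  congr (_ + _); apply: eq_big_seq => r r_ws; rewrite !inE.
  by case: (eqVneq r q) r_ws => [->|_] //=; rewrite (negPf q_ws).
have IH' b := IH ws_u (fun U s r (rws : r \in ws) => Fign U s r (mem_behead (s := q :: ws) rws))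
  Fle (if b then q |: U else U) (s + w q * (b%:R - p)).
have := ler_wpM2l p_ge0 (IH' true).
have p1_ge0 : 0 <= 1 - p by rewrite subr_ge0.
have := ler_wpM2l p1_ge0 (IH' false).
rewrite big_cons /H /=; set S := \sum_(_ <- _) _.
set u := bern_mean _ _; set v := bern_mean _ _ => le_u le_v.
apply: le_trans (lerD le_v le_u) _.
(* The slack is the gap between the variance p (1 - p) w^2 of the increment and the bound p w^2. *)
rewrite -subr_ge0.
have -> : (s ^+ 2 + (beta + p * (w q ^+ 2 + S))) * c -
  (p * (((s + w q * (1 - p)) ^+ 2 + (beta + p * S)) * c) +
   (1 - p) * (((s + w q * (0 - p)) ^+ 2 + (beta + p * S)) * c)) =
  (p * w q) ^+ 2 * c by ring.
by rewrite mulr_ge0 ?sqr_ge0.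
Qed.

Variables (St : Type) (cand used : St -> {set T}) (step : St -> {set T} -> St)
  (wt : St -> T -> R).
(** Together these three conditions say that a round reads only pairs never read before, so that
    they are independent of the current state. *)
Hypothesis step_local : forall st G, step st (G :&: cand st) = step st G.
Hypothesis cand_fresh : forall st, [disjoint cand st & used st].
Hypothesis used_step : forall st G, used st :|: cand st \subset used (step st G).

Definition increment st G : R := \sum_(q in cand st) wt st q * ((q \in G)%:R - p).
Definition cost st : R := \sum_(q in cand st) wt st q ^+ 2.

(* [beta] is the remaining budget for the costs: once it is exhausted, the running
   sum [s] is no longer watched. *)
Fixpoint exceeds (lam : R) k (s beta : R) st G : bool :=
  (lam <= `|s|) ||
  (if k is k'.+1 then
     (cost st <= beta) &&
     exceeds lam k' (s + increment st G) (beta - cost st) (step st G) G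
   else false).

Lemma exceeds_ignores lam k s beta st q : q \in used st ->
  ignores q (fun G => (exceeds lam k s beta st G)%:R : R).
Proof.
elim: k s beta st => [|k IH] s beta st q_used G //=.
have qc : q \notin cand st.
  by apply/negP => qc; have := disjointFr (cand_fresh st) qc; rewrite q_used.
have eqc r : r \in cand st -> (r \in q |: G) = (r \in G :\ q).
  by move=> rc; rewrite !inE; case: (eqVneq r q) rc qc => [-> ->|].
have -> : increment st (q |: G) = increment st (G :\ q).
  by apply: eq_bigr => r rc; rewrite eqc.
rewrite -[step st (_ |: _)]step_local -[step st (_ :\ _)]step_local.
have <- : (q |: G) :&: cand st = (G :\ q) :&: cand st.
  apply/setP => r; rewrite in_setI [RHS]in_setI.
  by case: (boolP (r \in cand st)) => rc; rewrite ?andbF // eqc.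
case: (lam <= `|s|) => //=; case: (cost st <= beta) => //=.
apply: IH; rewrite (fintype.subsetP (used_step _ _)) // inE q_used //.
Qed.

(* The potential [s ^+ 2 + p * beta] does not increase on average along the run. *)
Lemma adaptive_kolmogorov lam k s beta st : 0 < lam -> 0 <= beta ->
  bern_mean p (fun G => (exceeds lam k s beta st G)%:R) <=
  (s ^+ 2 + p * beta) / lam ^+ 2.
Proof.
move=> lam_gt0; elim: k s beta st => [|k IH] s beta st beta_ge0.
all: have [big|small] := lerP lam `|s|.
all: try (apply: le_trans (_ : bern_mean p (fun=> 1) <= _);
  [by apply: bern_mean_le => G; case: exceeds | rewrite bern_mean1];
  rewrite ler_pdivlMr ?exprn_gt0 // mul1r;
  have := mulr_ge0 p_ge0 beta_ge0;
  have : lam ^+ 2 <= s ^+ 2 by rewrite -(real_normK (num_real s)) lerXn2r // nnegrE // ltW);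
  try lra.
  rewrite /= [lam <= _]leNgt small /= (eq_bern_mean (g := fun=> 0)) //.
  rewrite /bern_mean big1 => [|G _]; last by rewrite mulr0.
  by rewrite divr_ge0 ?sqr_ge0 // addr_ge0 ?sqr_ge0 ?mulr_ge0.
rewrite /= [lam <= _]leNgt small /=; have [cost_le|_] := lerP (cost st) beta; last first.
  rewrite /bern_mean big1 => [|G _]; last by rewrite mulr0.
  by rewrite divr_ge0 ?sqr_ge0 // addr_ge0 ?sqr_ge0 ?mulr_ge0.
pose F U t G : R := (exceeds lam k t (beta - cost st) (step st U) G)%:R.
have := @bern_mean_reveal_seq (enum (cand st)) (wt st) (p * (beta - cost st))
  (lam ^+ 2)^-1 F _ (enum_uniq _) _ _ set0 s.
rewrite !big_enum /= => H.
rewrite (eq_bern_mean (g := (fun G => F (finset.set0 :|: [set q0 in enum (cand st) | q0 \in G])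
             (s + \sum_(q0 <- enum (cand st)) wt st q0 * ((q0 \in G)%:R - p)) G))).
  apply: le_trans (H _ _ _) _.
  - by rewrite invr_ge0 sqr_ge0.
  - move=> U t q; rewrite mem_enum => qc; apply: exceeds_ignores.
    by rewrite (fintype.subsetP (used_step _ _)) // inE qc orbT.
  - by move=> U t; apply: IH; rewrite subr_ge0.
  by rewrite ler_wpM2r ?invr_ge0 ?sqr_ge0 // /cost; lra.
move=> G; rewrite /F big_enum /= /increment -[step st G]step_local.
congr (exceeds _ _ _ _ (step st _) _)%:R; apply/setP => q.
by rewrite !inE mem_enum andbC.
Qed.

Fixpoint strategy_run k st G := if k is k'.+1 then strategy_run k' (step st G) G else st.

(** The budget is tested up to round [j] only. So a cost bound obtained along the trajectory itself,
    as for surplus pairs, suffices even if later rounds overspend. *)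
Lemma exceedsN lam k s beta st G : ~~ exceeds lam k s beta st G ->
  forall j, (j <= k)%N -> \sum_(i < j) cost (strategy_run i st G) <= beta ->
  `|s + \sum_(i < j) increment (strategy_run i st G) G| < lam.
Proof.
elim: k s beta st => [|k IH] s beta st /=; rewrite negb_or -ltNge => /andP[s_lt].
  by move=> _ j; rewrite leqn0 => /eqP ->; rewrite !big_ord0 addr0.
move=> H [|j]; first by rewrite !big_ord0 addr0.
rewrite ltnS !big_ord_recl /= => jk cost_le.
move: H; have -> /= : cost st <= beta.
  apply: le_trans cost_le; rewrite lerDl sumr_ge0 // => i _.
  by apply: sumr_ge0 => q _; apply: sqr_ge0.
move=> /IH /(_ j jk); rewrite addrA; apply; rewrite lerBrDl //.
Qed.

End AdaptiveKolmogorov.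

(** * Exploration of a bipartite graph *)

Section Exploration.
Variable n : nat.

(* [true] stands for the left class and [false] for the right class. *)
Definition opair (s : bool) (i j : 'I_n) : 'I_n * 'I_n := if s then (i, j) else (j, i).

Record xstate := XState {
  done : {ffun bool -> {set 'I_n}};
  seen : {ffun bool -> {set 'I_n}} }.

Implicit Types (st : xstate) (s : bool) (G U : bipgraph n).

Definition active st s := seen st s :\: done st s.

Definition idle st := (active st true == finset.set0) && (active st false == finset.set0).

(* Serving the larger active class makes the numbers of processed vertices of the
   two classes balance themselves; starting in the class with fewer processed
   vertices does the same when most components are small. *)
Definition turn st : bool :=
  if idle st then #|done st true| <= #|done st false|
  else #|active st false| <= #|active st true|.

Definition pool st := if idle st then ~: done st (turn st) else active st (turn st).

Definition next_vertex st := [pick i in pool st].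

(** Along a run [done] is contained in [seen], but freshness of the revealed pairs is demanded at
    every state; hence the union. *)
Definition tree_pairs st : {set 'I_n * 'I_n} :=
  if next_vertex st is Some i then
    [set opair (turn st) i j | j in ~: (done st (~~ turn st) :|: seen st (~~ turn st))]
  else finset.set0.

Definition surplus_pairs st : {set 'I_n * 'I_n} :=
  if next_vertex st is Some i then
    [set opair (turn st) i j | j in active st (~~ turn st)]
  else finset.set0.

Definition revealed_pairs st := tree_pairs st :|: surplus_pairs st.

Definition used_pairs st : {set 'I_n * 'I_n} :=
  [set q | (q.1 \in done st true) || (q.2 \in done st false)].

Definition xstep st U : xstate :=
  if next_vertex st is Some i then
    let s := turn st in
    XState [ffun r => if r == s then i |: done st r else done st r]
           [ffun r => if r == s then i |: seen st r
              else seen st r :|: [set j | (j \notin done st r) && (opair s i j \in U)]]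
  else st.

Definition xstate0 := XState [ffun=> finset.set0] [ffun=> finset.set0].

Lemma opair_inj s i : injective (opair s i).
Proof. by case: s => j k []. Qed.

Lemma opairC s i j : opair (~~ s) i j = opair s j i.
Proof. by case: s. Qed.

Lemma mem_opair_used st s i j :
  (opair s i j \in used_pairs st) = (i \in done st s) || (j \in done st (~~ s)).
Proof. by rewrite inE; case: s => //=; rewrite orbC. Qed.

Lemma next_vertex_notin st i : next_vertex st = Some i -> i \notin done st (turn st).
Proof.
rewrite /next_vertex /pool; case: pickP => // j + [<-].
by case: ifP => _; rewrite !inE // => /andP[].
Qed.

Lemma mem_revealed st s i j : next_vertex st = Some i -> s = turn st ->
  (opair s i j \in revealed_pairs st) = (j \notin done st (~~ s)).
Proof.
move=> nv ->; rewrite /revealed_pairs /tree_pairs /surplus_pairs nv inE.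
rewrite !mem_imset ?inE; try exact: opair_inj.
by case: (j \in done _ _); case: (j \in seen _ _).
Qed.

Lemma revealedP st q : q \in revealed_pairs st ->
  exists i j, [/\ next_vertex st = Some i, q = opair (turn st) i j &
                  j \notin done st (~~ turn st)].
Proof.
rewrite /revealed_pairs /tree_pairs /surplus_pairs.
case nv: (next_vertex st) => [i|]; last by rewrite !inE.
by rewrite inE => /orP[] /imsetP[j] + ->; rewrite !inE => jP; exists i, j;
  split=> //; move: jP; case: (j \in done _ _).
Qed.

Lemma revealed_fresh st : [disjoint revealed_pairs st & used_pairs st].
Proof.
rewrite disjoint_subset; apply/fintype.subsetP => q /revealedP[i [j [nv -> jd]]].
by rewrite inE mem_opair_used (negPf jd) (negPf (next_vertex_notin nv)).
Qed.

Lemma xstep_local st U : xstep st (U :&: revealed_pairs st) = xstep st U.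
Proof.
rewrite /xstep; case nv: (next_vertex st) => [i|] //; congr XState.
apply/ffunP => r; rewrite !ffunE; case: eqP => [//|/eqP rs].
have -> : r = ~~ turn st by move: rs; case: r; case: (turn st).
congr (_ :|: _); apply/setP => j; rewrite !inE -in_setU -/(revealed_pairs st).
by rewrite (mem_revealed _ nv erefl); case: (j \in done _ _); rewrite //= andbT.
Qed.

Lemma used_xstep st U :
  used_pairs st :|: revealed_pairs st \subset used_pairs (xstep st U).
Proof.
apply/fintype.subsetP => q; rewrite inE => /orP[|/revealedP[i [j [nv -> _]]]]; last first.
  by rewrite mem_opair_used /xstep nv /= ffunE eqxx !inE eqxx.
rewrite !inE /xstep; case nv: (next_vertex st) => [i|] //=; rewrite !ffunE.
by case/orP => H; case: (turn st) => /=; rewrite ?inE H ?orbT.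
Qed.

Section Run.
Variable G : bipgraph n.

Definition run k := strategy_run xstep k xstate0 G.

Lemma strategy_runS k st : strategy_run xstep k.+1 st G = xstep (strategy_run xstep k st G) G.
Proof. by elim: k st => //= k IH st; rewrite -IH. Qed.

Lemma runS k : run k.+1 = xstep (run k) G.
Proof. exact: strategy_runS. Qed.

Lemma done_seen k s : done (run k) s \subset seen (run k) s.
Proof.
elim: k s => [|k IH] s; first by rewrite !ffunE.
rewrite runS /xstep; case nv: next_vertex => [i|] //=; rewrite !ffunE.
case: eqP => _; first exact: setUS.
by rewrite (fintype.subset_trans (IH s)) // finset.subsetUl.
Qed.

Lemma card_seen k s : #|seen (run k) s| = #|done (run k) s| + #|active (run k) s|.
Proof. by rewrite /active cardsD (finset.setIidPr (done_seen k s)) subnKC // subset_leq_card // done_seen. Qed.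

(** A busy state serves the larger active class, which is nonempty. An idle state serves the class
    with fewer processed vertices, so if that class is exhausted the other one is too. *)
Lemma next_vertex_none k : next_vertex (run k) = None ->
  forall s, done (run k) s = [set: 'I_n].
Proof.
rewrite /next_vertex /pool; case: pickP => // p0 _.
case id: (idle _) p0 => p0; last first.
  suff : active (run k) (turn (run k)) = finset.set0.
    rewrite /turn id; have := id; rewrite /idle.
    case: (leqP #|_| #|_|) => le /negbT idF A0; move: idF.
      by move: le; rewrite A0 cards0 leqn0 cards_eq0 => ->; rewrite eqxx.
    by rewrite A0 eqxx andbT; move: le; rewrite A0 cards0.
  by apply/setP => i; rewrite p0 inE.
have full : done (run k) (turn (run k)) = [set: 'I_n].
  by apply/setP => i; have := p0 i; rewrite !inE => /negbFE.
have card_le s : #|done (run k) s| <= n by rewrite -[leqRHS]card_ord max_card.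
suff fullN : done (run k) (~~ turn (run k)) = [set: 'I_n].
  by case=> //; move: full fullN; case: (turn _).
apply/eqP; rewrite eqEcard finset.subsetT cardsT card_ord /=.
have : #|done (run k) (turn (run k))| = n by rewrite full cardsT card_ord.
rewrite /turn id; case: leqP => le cf; apply: leq_trans (eq_leq (esym cf)) _ => //.
exact: ltnW.
Qed.

Lemma card_done k : k <= 2 * n -> #|done (run k) true| + #|done (run k) false| = k.
Proof.
elim: k => [|k IH] k_lt; first by rewrite !ffunE cards0.
have {}IH := IH (ltnW k_lt).
rewrite runS /xstep; case nv: next_vertex => [i|]; last first.
  by move: IH k_lt; rewrite !(next_vertex_none nv) cardsT card_ord; lia.
have := next_vertex_notin nv; rewrite /= !ffunE.
by case: (turn _) => /= id; rewrite cardsU1 id add1n ?addSn ?addnS IH.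
Qed.

Lemma next_vertex_some k : k < 2 * n -> exists i, next_vertex (run k) = Some i.
Proof.
move=> k_lt; case nv: (next_vertex _) => [i|]; first by exists i.
by have := card_done (ltnW k_lt); rewrite !(next_vertex_none nv) cardsT card_ord; lia.
Qed.

Definition tree_hits k := #|G :&: tree_pairs (run k)|.
Definition surplus_hits k := #|G :&: surplus_pairs (run k)|.

Lemma card_tree_pairs k : k < 2 * n ->
  #|tree_pairs (run k)| = n - #|seen (run k) (~~ turn (run k))|.
Proof.
move=> /next_vertex_some[i nv]; rewrite /tree_pairs nv card_imset; last exact: opair_inj.
rewrite (finset.setUidPr (done_seen _ _)) [LHS]cardsCs finset.setCK card_ord //.
Qed.

Lemma card_surplus_pairs k : k < 2 * n ->
  #|surplus_pairs (run k)| = #|active (run k) (~~ turn (run k))|.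
Proof.
by move=> /next_vertex_some[i nv]; rewrite /surplus_pairs nv card_imset //; exact: opair_inj.
Qed.

Lemma card_done_step k s : k < 2 * n ->
  #|done (run k.+1) s| = #|done (run k) s| + (s == turn (run k)).
Proof.
move=> /next_vertex_some[i nv]; rewrite runS /xstep nv /= ffunE.
case: eqP => [->|_]; last by rewrite addn0.
by rewrite cardsU1 next_vertex_notin // addnC.
Qed.

Lemma card_seen_turn k : k < 2 * n ->
  #|seen (run k.+1) (turn (run k))| = #|seen (run k) (turn (run k))| + idle (run k).
Proof.
move=> /next_vertex_some[i nv]; rewrite runS /xstep nv /= ffunE eqxx cardsU1 addnC.
congr (_ + _)%N; congr nat_of_bool.
move: nv; rewrite /next_vertex /pool; case: pickP => // j + [<-].
case id: (idle _); rewrite !inE; last by case/andP => _ ->.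
move=> jd; apply/negP => js; move: id; rewrite /idle => /andP[/eqP a1 /eqP a2].
have : j \in active (run k) (turn (run k)) by rewrite inE jd js.
by case: (turn _); rewrite ?a1 ?a2 inE.
Qed.

Lemma card_seen_other k : k < 2 * n ->
  #|seen (run k.+1) (~~ turn (run k))| =
  #|seen (run k) (~~ turn (run k))| + tree_hits k.
Proof.
move=> /next_vertex_some[i nv]; rewrite /tree_hits runS /xstep /tree_pairs nv /= ffunE.
have -> : (~~ turn (run k) == turn (run k)) = false by case: (turn _).
set r := ~~ _; set N := [set j | _].
rewrite (finset.setUidPr (done_seen _ _)).
have -> : G :&: [set opair (turn (run k)) i j | j in ~: seen (run k) r] =
  [set opair (turn (run k)) i j | j in N :\: seen (run k) r].
  apply/setP => q; rewrite inE; apply/andP/imsetP => [[qG /imsetP[j]]|[j]].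
    rewrite inE => js qE; exists j => //; rewrite !inE js -qE qG andbT /=.
    by apply: contra js; apply/fintype.subsetP/done_seen.
  rewrite !inE => /and3P[js _ jG] ->; split=> //.
  by rewrite mem_imset ?inE //; exact: opair_inj.
rewrite card_imset; last exact: opair_inj.
by rewrite cardsU cardsD finset.setIC addnBA // subset_leq_card // finset.subsetIl.
Qed.

Lemma seen_stepP k r w : w \in seen (run k.+1) r ->
  [\/ w \in seen (run k) r,
      next_vertex (run k) = Some w /\ r = turn (run k) |
      exists2 i, next_vertex (run k) = Some i &
        r = ~~ turn (run k) /\ opair (turn (run k)) i w \in G].
Proof.
rewrite runS /xstep; case nv: next_vertex => [i|] //=; last by constructor 1.
rewrite ffunE; case: eqP => [->|/eqP rs]; rewrite !inE.
  by case/predU1P => [->|]; [constructor 2 | constructor 1].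
case/orP => [|/andP[_ iwG]]; [by constructor 1 | constructor 3; exists i => //].
by split=> //; move: rs; case: r; case: turn.
Qed.

Lemma done_stepP k r w : w \in done (run k.+1) r ->
  w \in done (run k) r \/ (next_vertex (run k) = Some w /\ r = turn (run k)).
Proof.
rewrite runS /xstep; case nv: next_vertex => [i|] //=; last by left.
rewrite ffunE; case: eqP => [->|_]; last by left.
by rewrite !inE => /predU1P[->|]; [right | left].
Qed.

Lemma seen_step k r : seen (run k) r \subset seen (run k.+1) r.
Proof.
rewrite runS /xstep; case nv: next_vertex => [i|] //=; rewrite ffunE.
by case: eqP => _; [exact: finset.subsetUr | exact: finset.subsetUl].
Qed.

Lemma done_step k r : done (run k) r \subset done (run k.+1) r.
Proof.
rewrite runS /xstep; case nv: next_vertex => [i|] //=; rewrite ffunE.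
by case: eqP => _ //; exact: finset.subsetUr.
Qed.

Lemma done_mono k l r : k <= l -> done (run k) r \subset done (run l) r.
Proof.
move=> /subnK <-; elim: (l - k) => // m IH.
by rewrite addSn (fintype.subset_trans IH) // done_step.
Qed.

(** At an idle state nothing discovered is left unprocessed, so this makes the processed set there a
    union of components. *)
Lemma done_closed k s i j :
  i \in done (run k) s -> opair s i j \in G -> j \in seen (run k) (~~ s).
Proof.
elim: k => [|k IH] in s i j *; first by rewrite ffunE inE.
case/done_stepP => [/IH H ijG|[nv ->] ijG].
  by rewrite (fintype.subsetP (seen_step _ _)) // H.
rewrite runS /xstep nv /= ffunE; have -> : (~~ turn (run k) == turn (run k)) = false.
  by case: (turn _).
rewrite !inE ijG andbT; case: (boolP (j \in done _ _)); rewrite ?orbT //.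
by move=> /(fintype.subsetP (done_seen _ _)) ->.
Qed.

(** * Components as blocks of rounds between idle states *)

Lemma idle_seen st s : idle st -> seen st s \subset done st s.
Proof. by rewrite -setD_eq0 => /andP[]; case: s. Qed.

Lemma idleE k s : idle (run k) -> seen (run k) s = done (run k) s.
Proof. by move=> id; apply/eqP; rewrite eqEsubset idle_seen // done_seen. Qed.

Definition emb s (i : 'I_n) : 'I_n + 'I_n := if s then inl i else inr i.

Definition vset st : {set 'I_n + 'I_n} :=
  [set v | match v with inl i => i \in done st true | inr i => i \in done st false end].

Lemma mem_vset st s i : (emb s i \in vset st) = (i \in done st s).
Proof. by rewrite inE; case: s. Qed.

Lemma bip_adj_emb s i j : bip_adj G (emb s i) (emb (~~ s) j) = (opair s i j \in G).
Proof. by case: s. Qed.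

Lemma bip_adjP u v : bip_adj G u v ->
  exists s i j, [/\ u = emb s i, v = emb (~~ s) j & opair s i j \in G].
Proof.
by case: u => i; case: v => j //= ijG; [exists true | exists false]; exists i, j.
Qed.

Lemma embP v : exists s i, v = emb s i.
Proof. by case: v => i; [exists true | exists false]; exists i. Qed.

Lemma bip_connect_sym : connect_sym (bip_adj G).
Proof. exact: sym_connect_sym (bip_adj_sym G). Qed.

Lemma idle_closed k : idle (run k) -> fingraph.closed (bip_adj G) (vset (run k)).
Proof.
move=> id; apply: intro_closed; first exact: bip_connect_sym.
move=> u v /bip_adjP[s [i [j [-> -> ijG]]]]; rewrite !mem_vset => /done_closed.
by move=> /(_ _ ijG); rewrite idleE.
Qed.

Lemma card_vset k : k <= 2 * n -> #|vset (run k)| = k.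
Proof.
move=> k_le; rewrite -[RHS](card_done k_le).
have -> : vset (run k) = [set emb true i | i in done (run k) true] :|:
                         [set emb false i | i in done (run k) false].
  apply/setP => v; have [s [i ->]] := embP v; rewrite mem_vset inE.
  case: s => /=.
    rewrite mem_imset => [|? ? []//]; case: (i \in _) => //=.
    by apply/esym/negP => /imsetP[].
  rewrite [X in _ || X]mem_imset => [|? ? []//]; case: (i \in _); rewrite ?orbT //= orbF.
  by apply/esym/negP => /imsetP[].
rewrite cardsU !card_imset; try by move=> ? ? [].
have -> : [set emb true i | i in done (run k) true] :&:
          [set emb false i | i in done (run k) false] = finset.set0; last by rewrite cards0 subn0.
by apply/setP => v; rewrite !inE; apply/negP => /andP[/imsetP[i _ ->] /imsetP[]].
Qed.

Definition block (s t : nat) :=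
  [/\ s < t, idle (run s), idle (run t) & forall k, s < k < t -> ~~ idle (run k)].

Section Block.
Variables (s t : nat).
Hypotheses (st_block : block s t) (t_le : t <= 2 * n).

Let s_lt : s < 2 * n. Proof. by case: st_block => st _ _ _; apply: leq_trans st t_le. Qed.

(** The root is the vertex picked at the idle round [s]. In every later round of the block the
    served vertex is active, hence already connected to the root, and so are the vertices it
    discovers. *)
Lemma block_root : exists2 root : 'I_n + 'I_n, root \in vset (run t) :\: vset (run s) &
  forall k r w, s < k <= t -> w \in seen (run k) r -> w \notin done (run s) r ->
    connect (bip_adj G) root (emb r w).
Proof.
have [s_t idle_s idle_t busy] := st_block.
have [i nv] := next_vertex_some s_lt; exists (emb (turn (run s)) i).
  rewrite in_setD !mem_vset next_vertex_notin //=.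
  apply: (fintype.subsetP (done_mono _ s_t)).
  by rewrite runS /xstep nv /= ffunE eqxx setU11.
elim=> // k IH r w /andP[]; rewrite ltnS leq_eqVlt => /predU1P[<- _|s_k k_t].
  case/seen_stepP; first by rewrite idleE // => ->.
    by case; rewrite nv => -[->] -> _.
  case=> j; rewrite nv => -[<-] [-> iwG] _.
  by apply: connect1; rewrite bip_adj_emb.
have {}IH := IH _ _ (introT andP (conj s_k (ltnW k_t))).
have conn j : next_vertex (run k) = Some j ->
    connect (bip_adj G) (emb (turn (run s)) i) (emb (turn (run k)) j).
  move=> nvk; apply: IH; last first.
    apply: contra (next_vertex_notin nvk).
    exact: (fintype.subsetP (done_mono _ (ltnW s_k))).
  move: nvk; rewrite /next_vertex /pool (negPf (busy _ _)) ?s_k //.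
  by case: pickP => // ? + [<-]; rewrite inE => /andP[].
case/seen_stepP; first exact: IH.
  by case=> nvk -> _; exact: conn.
case=> j nvk [-> jwG] _; apply: connect_trans (conn _ nvk) _.
by apply: connect1; rewrite bip_adj_emb.
Qed.

Lemma block_connect : exists root,
  vset (run t) :\: vset (run s) = [set v | connect (bip_adj G) root v].
Proof.
have [s_t idle_s idle_t _] := st_block.
have [root rootC conn] := block_root; exists root.
apply/setP => v; rewrite [RHS]inE; apply/idP/idP.
  have [r [w ->]] := embP v; rewrite in_setD !mem_vset => /andP[wn wd].
  by apply: (conn t) wn; rewrite ?s_t ?leqnn // (fintype.subsetP (done_seen _ _)).
(* Conversely, both processed sets are closed under adjacency, hence so is their difference. *)
move=> rv; move: rootC; rewrite !in_setD.
by rewrite (closed_connect (idle_closed idle_s) rv) (closed_connect (idle_closed idle_t) rv).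
Qed.

Lemma block_component : vset (run t) :\: vset (run s) \in components (bip_adj G).
Proof.
have [root ->] := block_connect; apply/imsetP; exists root => //.
by apply/setP => v; rewrite !inE.
Qed.

Lemma card_block : #|vset (run t) :\: vset (run s)| = t - s.
Proof.
have [s_t _ _ _] := st_block.
rewrite cardsD (finset.setIidPr _) ?card_vset //; first exact: ltnW.
apply/fintype.subsetP => v; have [r [w ->]] := embP v; rewrite !mem_vset.
exact: (fintype.subsetP (done_mono _ (ltnW s_t))).
Qed.

End Block.

Lemma used_runS k : used_pairs (run k.+1) = used_pairs (run k) :|: revealed_pairs (run k).
Proof.
apply/eqP; rewrite eqEsubset runS used_xstep andbT -runS.
apply/fintype.subsetP => q.
have [s [i [j ->]]] : exists s i j, q = opair s i j by exists true, q.1, q.2; case: q.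
rewrite mem_opair_used in_setU => /orP[] /done_stepP[|[nv sE]].
- by rewrite mem_opair_used => ->.
- rewrite (mem_revealed _ nv sE) mem_opair_used.
  by case: (j \in done _ _); rewrite ?orbT.
- by rewrite mem_opair_used => ->; rewrite orbT.
rewrite -[s]negbK opairC (mem_revealed _ nv sE) mem_opair_used negbK.
by case: (i \in done _ s); rewrite ?orbT.
Qed.

Lemma card_used_runS k :
  #|G :&: used_pairs (run k.+1)| = #|G :&: used_pairs (run k)| + (tree_hits k + surplus_hits k).
Proof.
rewrite used_runS finset.setIUr cardsU.
have -> : G :&: used_pairs (run k) :&: (G :&: revealed_pairs (run k)) = finset.set0.
  apply/setP => q; rewrite !in_setI in_set0; apply/negP => /andP[/andP[_ qu] /andP[_ qr]].
  by have := disjointFr (revealed_fresh (run k)) qr; rewrite qu.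
rewrite cards0 subn0; congr (_ + _)%N.
rewrite finset.setIUr cardsU; have -> : G :&: tree_pairs (run k) :&: (G :&: surplus_pairs (run k)) = finset.set0.
  apply/setP => q; rewrite !in_setI in_set0; apply/negP => /andP[/andP[_ +] /andP[_]].
  rewrite /tree_pairs /surplus_pairs; case: next_vertex => [i|]; last by rewrite inE.
  move=> /imsetP[j + ->]; rewrite mem_imset; last exact: opair_inj.
  by rewrite !inE; case: (j \in seen _ _); rewrite ?orbT ?andbF.
by rewrite cards0 subn0.
Qed.

Lemma card_seen_step k : k < 2 * n ->
  #|seen (run k.+1) true| + #|seen (run k.+1) false| =
  #|seen (run k) true| + #|seen (run k) false| + (idle (run k) + tree_hits k).
Proof.
move=> k_lt; have := card_seen_turn k_lt; have := card_seen_other k_lt.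
by case: (turn _) => /= -> ->; rewrite addnACA // (addnC (tree_hits k)).
Qed.

Lemma edges_in_block (s t : nat) : block s t -> t <= 2 * n ->
  #|edges_in (bip_adj G) (vset (run t) :\: vset (run s))| =
  (\sum_(s <= k < t) (tree_hits k + surplus_hits k))%N.
Proof.
move=> [s_t idle_s idle_t _] t_le.
have -> : edges_in (bip_adj G) (vset (run t) :\: vset (run s)) =
    [set [set inl q.1; inr q.2] | q in (G :&: used_pairs (run t)) :\: used_pairs (run s)].
  apply/setP => E; apply/imset2P/imsetP.
    case=> u v uC; rewrite inE => /andP[vC /bip_adjP[r [i [j [discovered_noise vE ijG]]]] ->].
    exists (opair r i j); last by subst; case: r {uC vC ijG} => //=; rewrite finset.setUC.
    move: uC vC; rewrite discovered_noise vE !in_setD !mem_vset in_setI ijG !mem_opair_used.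
    by move=> /andP[/negPf-> ->] /andP[/negPf-> ->].
  case=> -[i j]; rewrite in_setD in_setI -[(i, j)]/(opair true i j) !mem_opair_used /=.
  rewrite negb_or => /andP[/andP[i_s j_s] /andP[ijG ij_t]] ->.
  (* A used pair has only one end known to be processed; for an edge, closure at the idle state [t]
     supplies the other. *)
  have ji_t : (i \in done (run t) true) && (j \in done (run t) false).
    case/orP: ij_t => H; rewrite H ?andbT /=.
      by have := done_closed H ijG; rewrite idleE.
    by have := @done_closed t false j i H ijG; rewrite idleE.
  case/andP: ji_t => i_t j_t.
  exists (inl i) (inr j) => //; first by rewrite !inE i_s.
  by rewrite !inE j_s j_t.
rewrite card_imset; last first.
  move=> [i j] [i' j'] /= /setP E; have := E (inl i); have := E (inr j).
  by rewrite !inE !eqxx orbT orFb /= orbF => /esym/eqP [->] /esym/eqP[->].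
have telescope m : #|G :&: used_pairs (run (s + m))| = #|G :&: used_pairs (run s)| +
    \sum_(s <= k < s + m) (tree_hits k + surplus_hits k).
  elim: m => [|m IH]; first by rewrite addn0 big_geq // addn0.
  by rewrite addnS card_used_runS IH big_nat_recr ?leq_addr // [RHS]addnA.
have := telescope (t - s)%N; rewrite subnKC ?(ltnW s_t) // => total.
have sub : used_pairs (run s) \subset used_pairs (run t).
  apply/fintype.subsetP => -[i j]; rewrite -[(i, j)]/(opair true i j) !mem_opair_used.
  by move=> /orP[] /(fintype.subsetP (done_mono _ (ltnW s_t))) ->; rewrite ?orbT.
by rewrite cardsD -finset.setIA (finset.setIidPr sub) total addKn.
Qed.

(** Each of the t - s vertices of the block except its root is discovered through exactly one tree
    edge. *)
Lemma tree_hits_block (s t : nat) : block s t -> t <= 2 * n ->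
  (\sum_(s <= k < t) tree_hits k)%N = (t - s).-1.
Proof.
move=> [s_t idle_s idle_t busy] t_le.
have telescope m : s + m.+1 <= t ->
   #|seen (run (s + m.+1)) true| + #|seen (run (s + m.+1)) false| =
   (s + 1 + \sum_(s <= k < s + m.+1) tree_hits k)%N.
  elim: m => [|m IH] le_t.
    rewrite addn1 big_nat1 card_seen_step; last by lia.
    by rewrite !idleE // idle_s card_done; lia.
  rewrite addnS card_seen_step; last by lia.
  rewrite IH; last by lia.
  by rewrite (negPf (busy _ _)) ?big_nat_recr /=; lia.
have := telescope (t - s).-1; have -> : (s + (t - s).-1.+1 = t)%N by lia.
by rewrite !idleE // card_done // => /(_ (leqnn _)); lia.
Qed.

Lemma excess_block (s t : nat) : block s t -> t <= 2 * n ->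
  excess (bip_adj G) (vset (run t) :\: vset (run s)) =
  ((\sum_(s <= k < t) surplus_hits k)%N%:Z - 1)%R.
Proof.
move=> b t_le; rewrite /excess edges_in_block // card_block // big_split /= tree_hits_block //.
case: b => s_t _ _ _; lia.
Qed.

Lemma done_last r : done (run (2 * n)) r = [set: 'I_n].
Proof.
have := card_done (leqnn (2 * n)).
have : forall s, #|done (run (2 * n)) s| <= n by move=> s; rewrite -[leqRHS]card_ord max_card.
move=> /[dup] /(_ true) + /(_ false); rewrite mulSn mul1n => le1 le2 E.
apply/eqP; rewrite eqEcard finset.subsetT cardsT card_ord /=.
move: r le1 le2 E => []; move: #|done _ true| #|done _ false| => u v /= ? ? ?; lia.
Qed.

Lemma idle_last : idle (run (2 * n)).
Proof. by rewrite /idle /active !done_last !setDT eqxx. Qed.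

Lemma idle0 : idle (run 0).
Proof. by rewrite /idle /active !ffunE setD0 eqxx. Qed.

Lemma block_around k : k < 2 * n ->
  exists (s t : nat), [/\ block s t, t <= 2 * n & s <= k < t].
Proof.
move=> k_lt.
have exs : exists s : nat, (s <= k) && idle (run s) by exists 0; rewrite idle0.
have bs (s : nat) : (s <= k) && idle (run s) -> s <= k by case/andP.
case: (ex_maxnP exs bs) => s /andP[s_k idle_s] s_max.
have ext : exists t, (k < t) && idle (run t) by exists (2 * n); rewrite k_lt idle_last.
case: (ex_minnP ext) => t /andP[k_t idle_t] t_min.
exists s, t; split; rewrite ?s_k //; last by apply: t_min; rewrite k_lt idle_last.
split=> // [|j /andP[s_j j_t]]; first exact: leq_ltn_trans k_t.
apply/negP => idle_j; case: (leqP j k) => jk.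
  by have := s_max j; rewrite jk idle_j => /(_ isT); rewrite leqNgt s_j.
by have := t_min j; rewrite jk idle_j => /(_ isT); rewrite leqNgt j_t.
Qed.

(** The block is the one around the round in which a representative of [C] gets processed. *)
Lemma component_block C : C \in components (bip_adj G) ->
  exists (s t : nat), [/\ block s t, t <= 2 * n & C = vset (run t) :\: vset (run s)].
Proof.
move=> /imsetP[v _ ->]; have [r [w vE]] := embP v.
have exk : exists k, w \in done (run k) r.
  by exists (2 * n); rewrite done_last inE.
case: (ex_minnP exk) => -[|k wd k_min]; first by rewrite ffunE inE.
have wnd : w \notin done (run k) r by apply/negP => /k_min; rewrite ltnn.
have k_lt : k < 2 * n.
  rewrite ltnNge; apply/negP => le; move: wnd; rewrite (fintype.subsetP (done_mono _ le)) //.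
  by rewrite done_last inE.
have [s [t [b t_le /andP[s_k k_t]]]] := block_around k_lt.
exists s, t; split=> //; have [root CE] := block_connect b t_le.
have : v \in vset (run t) :\: vset (run s).
  rewrite in_setD vE !mem_vset (fintype.subsetP (done_mono _ k_t)) // andbT.
  by apply: contra wnd; exact: (fintype.subsetP (done_mono _ s_k)).
rewrite CE inE => rv; apply/setP => u; rewrite !inE /=.
by rewrite (same_connect bip_connect_sym rv).
Qed.

End Run.
End Exploration.

Local Open Scope ring_scope.

(** * The trajectory of the exploration *)

(* The squares of these weights sum to O(h) over all rounds, while weight times
   drift stays of order e in the subcritical regime. *)
Definition damping (R : realFieldType) (h : R) (j : nat) : R :=
  if j%:R <= 6 * h then 1 else 6 * h / j%:R.

(* After [k] rounds, [x r k] vertices of class [r] are processed, [a r k] are active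
   and [u r k] are discovered; [hit k] and [sur k] are the numbers of tree and of
   surplus edges revealed in round [k].  With N = n, the scales are h = e N for
   time, q = e^2 N for the number of active vertices and e q = e^3 N for the excess. *)
Section Trajectory.
Variables (R : realFieldType) (m : nat) (N e p : R).
Variables (x a : bool -> nat -> R) (turn idl : nat -> bool) (hit sur : nat -> R).
Variables (eta tau : R).

Let u r k := x r k + a r k.
Let h := e * N.
Let q := e * h.
Let L := eta * q.
Let w := damping h.

Let indic (r : bool) (k : nat) : R := (turn k == r)%:R.
Definition starts r k := \sum_(j < k) indic r j * (idl j)%:R.
(** In [noise r] and [met r] the index [r] is the serving class, so they describe discoveries in
    class [~~ r]; [met r] adds up the vertices no longer available to a tree edge. *)
Definition noise r k := \sum_(j < k) indic r j * (hit j - p * (N - u (~~ r) j)).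
Definition met r k := \sum_(j < k) indic r j * u (~~ r) j.
Definition wnoise r k :=
  \sum_(j < k) indic r j * (w j * (hit j - p * (N - u (~~ r) j))).
Definition surplus k := \sum_(j < k) a (~~ turn j) j.
Definition surplus_noise k := \sum_(j < k) (sur j - p * a (~~ turn j) j).

(** All that the deterministic analysis uses about the graph. [eta] is the tolerance on the noises
    and [tau] the resulting relative accuracy. The last bound is conditional because its budget is
    the number of surplus pairs, which is part of what has to be determined. *)
Record trajectory : Prop := Trajectory {
  x0 : forall r, x r 0 = 0;
  a0 : forall r, a r 0 = 0;
  a_ge0 : forall r k, 0 <= a r k;
  xS : forall r k, (k < m)%N -> x r k.+1 = x r k + (r == turn k)%:R;
  u_turn : forall k, (k < m)%N -> u (turn k) k.+1 = u (turn k) k + (idl k)%:R;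
  u_other : forall k, (k < m)%N -> u (~~ turn k) k.+1 = u (~~ turn k) k + hit k;
  idl_a : forall r k, idl k -> a r k = 0;
  idl_turn : forall k, idl k -> x (turn k) k <= x (~~ turn k) k;
  busy_turn : forall k, ~~ idl k -> a (~~ turn k) k <= a (turn k) k;
  N_gt0 : 0 < N;
  e_gt0 : 0 < e;
  p_mulN : p * N = 1 + e;
  eta_gt0 : 0 < eta;
  tau_le : tau <= 10^-1;
  eta_tau : 100 * eta <= tau;
  e_eta : 2000 * e <= eta;
  L_big : 100 <= L;
  cube_big : 1 <= eta * (e * q);
  wnoise_le : forall r k, (k <= m)%N -> `|wnoise r k| <= L;
  noise_full : forall r k, (k <= m)%N -> `|noise r k| <= eta * h;
  surplus_noise_le : forall k, (k <= m)%N -> surplus k <= 20 * (q * h) ->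
    `|surplus_noise k| <= eta * (e * q)
}.

Arguments xS _ r [k] _.
Arguments u_turn _ [k] _.
Arguments u_other _ [k] _.
Arguments idl_a _ r [k] _.
Arguments idl_turn _ [k] _.
Arguments busy_turn _ [k] _.
Arguments wnoise_le _ r [k] _.
Arguments noise_full _ r [k] _.
Arguments surplus_noise_le _ [k] _ _.

Hypothesis T : trajectory.

Ltac forget := repeat match goal with
  | H : ?P |- _ => tryif constr_eq H T then fail else
      (lazymatch type of P with Prop => clear H end)
  end.

Lemma xSE r k : (k < m)%N -> x r k.+1 = x r k + indic r k.
Proof. by move=> km; rewrite (xS T) // eq_sym. Qed.

Lemma processed_sum k : (k <= m)%N -> x true k + x false k = k%:R.
Proof.
elim: k => [|k IH] km; first by rewrite !(x0 T) addr0.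
rewrite !(xS T) // -natr1 -(IH (ltnW km)); case: (turn k) => /=; rewrite ?eqxx /=; ring.
Qed.

Lemma processed_ge0 r k : (k <= m)%N -> 0 <= x r k.
Proof.
elim: k => [|k IH] km; first by rewrite (x0 T).
by rewrite (xS T) // addr_ge0 // ?IH ?(ltnW km).
Qed.

Lemma processed_le r k : (k <= m)%N -> x r k <= k%:R.
Proof.
move=> km; have := processed_sum km; have := processed_ge0 true km; have := processed_ge0 false km.
case: r; lra.
Qed.

Lemma discovered_ge0 r k : (k <= m)%N -> 0 <= u r k.
Proof. by move=> km; rewrite addr_ge0 ?processed_ge0 ?(a_ge0 T). Qed.

Lemma startsS r k : starts r k.+1 = starts r k + indic r k * (idl k)%:R.
Proof. by rewrite /starts big_ord_recr. Qed.

Lemma noiseS r k :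
  noise r k.+1 = noise r k + indic r k * (hit k - p * (N - u (~~ r) k)).
Proof. by rewrite /noise big_ord_recr. Qed.

Lemma metS r k : met r k.+1 = met r k + indic r k * u (~~ r) k.
Proof. by rewrite /met big_ord_recr. Qed.

Lemma discovered_noise r k : (k <= m)%N ->
  u (~~ r) k = starts (~~ r) k + (1 + e) * x r k - p * met r k + noise r k.
Proof.
elim: k => [|k IH] km.
  by rewrite /starts /met /noise !big_ord0 /u !(x0 T) (a0 T); ring.
have {}IH := IH (ltnW km); rewrite startsS metS noiseS xSE // -(p_mulN T).
move: IH; rewrite -(p_mulN T); have := u_turn T km; have := u_other T km.
rewrite /indic; case: (turn k) r => -[] /= ut uf IH; rewrite ?(ut, uf) IH; ring.
Qed.

Let c k := starts true k + starts false k.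

Lemma indicE k : indic true k + indic false k = 1.
Proof. by rewrite /indic; case: (turn k) => /=; rewrite ?addr0 ?add0r. Qed.

Lemma starts_totalS k : c k.+1 = c k + (idl k)%:R.
Proof. by rewrite /c !startsS addrACA -mulrDl indicE mul1r. Qed.

Lemma starts_ge0 r k : 0 <= starts r k.
Proof. by apply: sumr_ge0 => j _; rewrite mulr_ge0. Qed.

Lemma starts_le_c r k : starts r k <= c k.
Proof. by case: r; rewrite /c ?lerDl ?lerDr starts_ge0. Qed.

Lemma starts_total_ge0 k : 0 <= c k.
Proof. by rewrite addr_ge0 ?starts_ge0. Qed.

Lemma starts_total_le k : c k <= k%:R.
Proof.
elim: k => [|k IH]; first by rewrite /c /starts !big_ord0 addr0.
by rewrite starts_totalS -natr1 lerD //; case: (idl k).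
Qed.

Lemma starts_total_mono k : c k <= c k.+1.
Proof. by rewrite starts_totalS lerDl. Qed.

(** * The first 6 h rounds *)

Lemma noise_early r k : (k <= m)%N -> k%:R <= 6 * h -> `|noise r k| <= L.
Proof.
move=> km kh; suff -> : noise r k = wnoise r k by exact: (wnoise_le T).
(* The weights equal 1 up to time 6 h, so the weighted inequality also controls the early plain
   noise. *)
apply: eq_bigr => j _; rewrite /w /damping ifT ?mul1r //.
by apply: le_trans kh; rewrite ler_nat ltnW.
Qed.

Lemma h_gt0 : 0 < h. Proof. by rewrite /h mulr_gt0 ?(e_gt0 T) ?(N_gt0 T). Qed.

Lemma q_gt0 : 0 < q. Proof. by rewrite /q mulr_gt0 ?h_gt0 ?(e_gt0 T). Qed.

Lemma L_le_q : 1000 * L <= q.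
Proof. by rewrite /L; have := q_gt0; move: (eta_tau T) (tau_le T); nra. Qed.

Lemma e_le : 5000 * e <= 1.
Proof. by move: (e_eta T) (eta_tau T) (tau_le T); lra. Qed.

Let invN := N^-1.

Lemma invN_gt0 : 0 < invN. Proof. by rewrite invr_gt0 (N_gt0 T). Qed.
Lemma mulVN : invN * N = 1. Proof. by rewrite mulVf // gt_eqF ?(N_gt0 T). Qed.
Lemma invN_h : invN * h = e. Proof. by rewrite /h mulrCA mulVN mulr1. Qed.
Lemma p_invN : p = (1 + e) * invN. Proof. by rewrite -(p_mulN T) -mulrA [N * _]mulrC mulVN mulr1. Qed.

Lemma invN_ge0 : 0 <= invN. Proof. exact: ltW invN_gt0. Qed.
Lemma e_ge0 : 0 <= e. Proof. exact: ltW (e_gt0 T). Qed.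

Lemma invN_le z : z <= 6 * h -> invN * z <= 6 * e.
Proof. by move=> zh; rewrite -invN_h mulrCA ler_wpM2l // invN_ge0. Qed.

Lemma met_ge0 r k : (k <= m)%N -> 0 <= met r k.
Proof. by move=> km; apply: sumr_ge0 => j _; rewrite mulr_ge0 ?discovered_ge0 // ltnW // (leq_trans (ltn_ord j)). Qed.

Lemma p_ge0 : 0 <= p.
Proof. by rewrite p_invN mulr_ge0 ?invN_ge0 ?e_ge0 //; move: (e_gt0 T); lra. Qed.

(** Beginning of a bootstrap on [met]: at most 6 h starts, about 6 h discoveries on average, and a
    small noise. *)
Lemma discovered_crude r k : (k <= m)%N -> k%:R <= 6 * h -> u (~~ r) k <= 14 * h.
Proof.
move=> km kh; rewrite discovered_noise //.
have := mulr_ge0 p_ge0 (met_ge0 r km).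
have := noise_early r km kh; rewrite ler_norml => /andP[_].
have := starts_le_c (~~ r) k; have := starts_total_le k; have := processed_le r km.
have := L_le_q; have := e_le; have := h_gt0; have : q <= h.
  by rewrite /q; have := e_le; have := h_gt0; nra.
have := processed_ge0 r km; move: (e_gt0 T).
set X := x r k; set P := p * _ => eg Xge qh hg es Lq Xk ck sc nz Pge.
have : e * X <= X / 100 by move: Xge es; forget; nra.
move: qh hg Lq Xk ck sc nz Pge kh; forget; lra.
Qed.

Lemma met_crude r k : (k <= m)%N -> k%:R <= 6 * h -> met r k <= 14 * h * x r k.
Proof.
elim: k => [|k IH] km kh; first by rewrite /met big_ord0 (x0 T) mulr0.
have kh' : k%:R <= 6 * h by apply: le_trans kh; rewrite ler_nat.
have := IH (ltnW km) kh'; have := discovered_crude r (ltnW km) kh'.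
rewrite metS xSE // /indic; case: (_ == _) => /=; lra.
Qed.

Lemma discovered_near r k : (k <= m)%N -> k%:R <= 6 * h ->
  `|u (~~ r) k - starts (~~ r) k - x r k| <= 97 * q.
Proof.
move=> km kh; rewrite discovered_noise //.
have := noise_early r km kh; have := met_crude r km kh; have := met_ge0 r km.
have := processed_le r km; have := processed_ge0 r km; have := L_le_q; have := q_gt0; have := e_le.
rewrite p_invN; set X := x r k; set Q := met r k.
move=> es qg Lq Xg Xk Qg Qle nz.
have iXe : invN * X <= 6 * e by apply: invN_le; lra.
(* Here 84 = 14 * 6, from [met_crude] and x / N <= 6 e. *)
have iQ : invN * Q <= 84 * q.
  apply: (@le_trans _ _ (invN * (14 * h * X))); first by rewrite ler_wpM2l ?invN_ge0 ?e_ge0.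
  have -> : invN * (14 * h * X) = 14 * h * (invN * X) by ring.
  by rewrite /q; have := h_gt0; move: iXe; forget; nra.
have iQg : 0 <= invN * Q by rewrite mulr_ge0 ?invN_ge0 ?e_ge0.
have eX : e * X <= 6 * q by rewrite /q; move: (e_gt0 T) Xk kh; forget; nra.
have eX0 : 0 <= e * X by rewrite mulr_ge0 ?e_ge0.
have -> : starts (~~ r) k + (1 + e) * X - (1 + e) * invN * Q + noise r k - starts (~~ r) k - X
  = e * X - (invN * Q) - e * (invN * Q) + noise r k by ring.
have : e * (invN * Q) <= q by move: iQ iQg es qg; forget; nra.
have : 0 <= e * (invN * Q) by rewrite mulr_ge0 ?e_ge0.
move: nz iQ iQg eX eX0 Lq qg; rewrite !ler_norml; forget; lra.
Qed.

(** Whenever [x r] grows by one, [met r] grows by [u (~~ r)], which is close to [x r]; so [met r] is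
    a discrete integral of [x r]. The starts are not bounded yet and stay in the error. *)
Lemma met_near r k : (k <= m)%N -> k%:R <= 6 * h ->
  `|met r k - x r k ^+ 2 / 2| <= x r k * (c k + 98 * q).
Proof.
elim: k => [|k IH] km kh.
  by rewrite /met big_ord0 (x0 T) expr0n /= mul0r subr0 normr0 mul0r.
have kh' : k%:R <= 6 * h by apply: le_trans kh; rewrite ler_nat.
have := IH (ltnW km) kh'; have := discovered_near r (ltnW km) kh'.
have := starts_total_mono k; have := starts_total_ge0 k; have := starts_le_c (~~ r) k; have := starts_ge0 (~~ r) k.
have := processed_ge0 r (ltnW km); have := L_le_q; have := L_big T.
rewrite metS xSE // /indic; set X := x r k; set U := u _ _; set Q := met _ _.
move=> Lb Lq Xg sg sc cg cm.
rewrite !ler_norml; case: (_ == _) => /=; rewrite ?mul1r ?mul0r ?addr0 => /andP[u1 u2] /andP[m1 m2].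
  have : 0 <= X * (c k.+1 - c k) by rewrite mulr_ge0 // subr_ge0.
  by move: Lb Lq Xg sg sc cg cm u1 u2 m1 m2; forget => *; apply/andP; split; lra.
have : 0 <= X * (c k.+1 - c k) by rewrite mulr_ge0 // subr_ge0.
by move: m1 m2; forget => *; apply/andP; split; lra.
Qed.

(** Predicted number of discoveries in one class when z vertices of the other are processed. The
    error [E] carries the unknown number of starts with a coefficient small enough to be absorbed
    later. *)
Let g z := (1 + e) * z - invN * z ^+ 2 / 2.
Let E k := 2 * L + c k / 100.

Lemma discovered_formula r k : (k <= m)%N -> k%:R <= 6 * h ->
  `|u (~~ r) k - starts (~~ r) k - g (x r k)| <= E k.
Proof.
move=> km kh; rewrite discovered_noise //.
have := noise_early r km kh; have := met_near r km kh.
have := processed_le r km; have := processed_ge0 r km; have := q_gt0; have := e_le; have := starts_total_ge0 k.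
rewrite p_invN /g /E; set X := x r k; set Q := met r k.
move=> cg es qg Xg Xk Qn nz.
have iXe : invN * X <= 6 * e by apply: invN_le; lra.
have iX0 : 0 <= invN * X by rewrite mulr_ge0 ?invN_ge0 ?e_ge0.
set d := Q - X ^+ 2 / 2 in Qn.
have iQ : `|invN * d| <= 6 * e * (c k + 98 * q).
  rewrite normrM (ger0_norm (invN_ge0)).
  apply: (@le_trans _ _ (invN * (X * (c k + 98 * q)))).
    by rewrite ler_wpM2l ?invN_ge0 ?e_ge0.
  by rewrite mulrA ler_wpM2r //; move: cg qg; forget; lra.
have -> : starts (~~ r) k + (1 + e) * X - (1 + e) * invN * Q + noise r k - starts (~~ r) k -
   ((1 + e) * X - invN * X ^+ 2 / 2) =
   noise r k - (1 + e) * (invN * d) - e * ((invN * X) * X) / 2 by rewrite /d; field.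
have Z0 : 0 <= e * (invN * X * X) by rewrite !mulr_ge0 ?invN_ge0 ?e_ge0.
have Z1 : e * (invN * X * X) <= 36 * (e * q).
  rewrite [36 * _]mulrCA ler_wpM2l ?e_ge0 // /q; move: (e_gt0 T) h_gt0 => ? ?.
  by apply: (@le_trans _ _ (6 * e * X)); [rewrite ler_wpM2r | nra].
have eqL : 2000 * (e * q) <= L by rewrite /L mulrA ler_wpM2r ?(e_eta T) // ltW.
have ec : 5000 * (e * c k) <= c k by rewrite mulrA ler_piMl.
set D := invN * d in iQ *.
have eD : `|e * D| <= 6 * e * (c k + 98 * q).
  rewrite normrM (ger0_norm e_ge0); apply: le_trans iQ.
  by rewrite ler_piMl ?normr_ge0 //; move: es (e_gt0 T); forget; lra.
move: nz iQ eD; rewrite !ler_norml => /andP[n1 n2] /andP[i1 i2] /andP[e1 e2].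
by move: n1 n2 i1 i2 e1 e2 eqL ec Z0 Z1 cg; forget => *; apply/andP; split; lra.
Qed.

(* [a r k - a (~~ r) k] exceeds the gap [x (~~ r) k - x r k] up to the errors, so a
   lagging class is the one with more active vertices. *)
Lemma turn_lagging r k : (k <= m)%N -> k%:R <= 6 * h ->
  51 / 50 * c k + 4 * L < x (~~ r) k - x r k -> turn k = r.
Proof.
move=> km kh gap; have := discovered_formula (~~ r) km kh; have := discovered_formula r km kh.
rewrite negbK; have iNk := invN_le kh; have := processed_sum km.
have := starts_le_c (~~ r) k; have := starts_ge0 r k; have := starts_total_ge0 k.
have := e_le; have := e_gt0 T; have := L_big T; rewrite /g /E.
move=> Lb eg es cg sr snr xs; rewrite !ler_norml => /andP[f1 f2] /andP[f3 f4].
have : a (~~ r) k < a r k.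
  have -> : a r k = u r k - x r k by rewrite /u; ring.
  have -> : a (~~ r) k = u (~~ r) k - x (~~ r) k by rewrite /u; ring.
  move: xs gap f1 f2 f3 f4 sr snr.
  have -> : x true k + x false k = x r k + x (~~ r) k by case: (r) => //=; rewrite addrC.
  set y := x (~~ r) k; set z := x r k => xs gap f1 f2 f3 f4 sr snr.
  have key : y - z <= (1 + e) * y - invN * y ^+ 2 / 2 + y - ((1 + e) * z - invN * z ^+ 2 / 2 + z).
    rewrite -subr_ge0.
    have -> : (1 + e) * y - invN * y ^+ 2 / 2 + y - ((1 + e) * z - invN * z ^+ 2 / 2 + z) - (y - z) =
      (y - z) * (1 + e - (invN * (z + y)) / 2) by field.
    rewrite mulr_ge0 // ?xs; move: gap cg Lb iNk es eg; forget; lra.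
  by move: gap cg f1 f2 f3 f4 sr snr key; forget; lra.
case: (boolP (idl k)) => [idk|busy]; first by rewrite !(idl_a T) // ltxx.
move=> lt_a; have := busy_turn T busy; case: (turn k) (r) lt_a => -[] //= lt_a;
  by rewrite leNgt lt_a.
Qed.

(** Beyond the threshold of [turn_lagging] only the lagging class is served, so the gap can
    overshoot it by at most one step. *)
Lemma balance r k : (k <= m)%N -> k%:R <= 6 * h ->
  x (~~ r) k - x r k <= 51 / 50 * c k + 4 * L + 1.
Proof.
elim: k => [|k IH] km kh.
  by rewrite !(x0 T); have := starts_total_ge0 0; have := L_big T; lra.
have kh' : k%:R <= 6 * h by apply: le_trans kh; rewrite ler_nat.
have := IH (ltnW km) kh'; have := starts_total_mono k; rewrite !(xS T) //.
have := turn_lagging (ltnW km) kh' (r := r).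
case: (ltrP (51 / 50 * c k + 4 * L) (x (~~ r) k - x r k)) => gap.
  by move=> /(_ isT) ->; rewrite eqxx; case: (r) => /=; lra.
by move=> _; case: (turn k) (r) gap => -[] /=; rewrite ?eqxx /=; lra.
Qed.

(** This is 2 g (k / 2) - k, the predicted active count without starts; it vanishes at 4 h. *)
Let f k : R := e * k%:R - invN * k%:R ^+ 2 / 4.

Lemma active_sum k : (k <= m)%N -> k%:R <= 6 * h ->
  `|a true k + a false k - c k - f k| <= 5 * L + c k / 25.
Proof.
move=> km kh; have := discovered_formula true km kh; have := discovered_formula false km kh.
have := balance true km kh; have := balance false km kh; have iNk := invN_le kh.
have := processed_ge0 true km; have := processed_ge0 false km; have := processed_sum km; have := starts_total_ge0 k.
have := e_le; have := e_gt0 T; have := L_big T; rewrite /g /E /f /= /u /c.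
set y := x false k; set z := x true k; set sy := starts false k; set sz := starts true k.
move=> Lb eg es cg xs yg zg d1 d2; rewrite !ler_norml => /andP[f1 f2] /andP[f3 f4].
(* An imbalance of the classes enters only through its square, divided by N, hence is negligible. *)
have xy2 : z ^+ 2 + y ^+ 2 = k%:R ^+ 2 / 2 + (z - y) ^+ 2 / 2 by rewrite -xs; field.
set D := 51 / 50 * (sz + sy) + 4 * L + 1 in d1 d2.
have d2le : (z - y) ^+ 2 <= k%:R * D by rewrite -xs; move: d1 d2 yg zg; forget; nra.
have d2_ge0 : 0 <= invN * (z - y) ^+ 2 by rewrite mulr_ge0 ?invN_ge0 ?sqr_ge0.
have : invN * (z - y) ^+ 2 <= D / 500.
  apply: (@le_trans _ _ (invN * (k%:R * D))); first by rewrite ler_wpM2l ?invN_ge0.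
  rewrite mulrA; apply: (@le_trans _ _ (6 * e * D)).
    by rewrite ler_wpM2r // /D; move: cg Lb; forget; lra.
  by rewrite /D; move: eg es cg Lb; forget; nra.
have -> : invN * k%:R ^+ 2 = 2 * (invN * z ^+ 2) + 2 * (invN * y ^+ 2) - invN * (z - y) ^+ 2.
  by rewrite -xs; ring.
move: d2_ge0; set W := invN * (z - y) ^+ 2; rewrite /D -xs => d20 dle.
by move: f1 f2 f3 f4 d20 dle Lb cg; forget => *; apply/andP; split; lra.
Qed.

Lemma drift_sum_ge0 k : k%:R <= 4 * h -> 0 <= f k.
Proof.
move=> kh; have -> : f k = invN * k%:R * (4 * h - k%:R) / 4 by rewrite /f -invN_h; field.
by rewrite divr_ge0 ?mulr_ge0 ?invN_ge0 ?subr_ge0.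
Qed.

(** At a start nothing is active, so [active_sum] with a nonnegative [f] gives (24/25) c <= 5 L
    before the new start is counted. *)
Lemma starts_bound k : (k <= m)%N -> k%:R <= 6 * h ->
  (forall j, (j < k)%N -> idl j -> j%:R <= 4 * h) -> c k <= 6 * L.
Proof.
elim: k => [|k IH] km kh idles.
  by rewrite /c /starts !big_ord0; have := L_big T; lra.
have kh' : k%:R <= 6 * h by apply: le_trans kh; rewrite ler_nat.
have {}IH := IH (ltnW km) kh' (fun j jk => idles j (ltnW jk)).
rewrite starts_totalS; case idk: (idl k); last by rewrite addr0.
have := active_sum (ltnW km) kh'; rewrite !(idl_a T) // ler_norml => /andP[f1 _].
have := drift_sum_ge0 (idles k (ltnSn k) idk); have := L_big T; rewrite /=; lra.
Qed.

Lemma tau_gt0 : 0 < tau. Proof. by move: (eta_gt0 T) (eta_tau T); lra. Qed.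

Lemma q_le_h : q <= h.
Proof. by rewrite /q; have := e_le; have := h_gt0; nra. Qed.

(** In this window [f] is at least tau q / 2 >= 50 L, more than the error in [active_sum] can
    cancel. *)
Lemma no_idle k : (k <= m)%N -> tau * h <= k%:R <= (4 - tau) * h -> ~~ idl k.
Proof.
move=> km /andP[k1 k2]; apply/negP => idk.
have kh : k%:R <= 6 * h by have := h_gt0; have := tau_gt0; nra.
have := active_sum km kh; rewrite !(idl_a T) // ler_norml => /andP[f1 f2].
have f_ge : tau * q / 2 <= f k.
  have -> : f k = invN * (k%:R * (4 * h - k%:R)) / 4 by rewrite /f -invN_h; field.
  have : invN * (2 * tau * h * h) <= invN * (k%:R * (4 * h - k%:R)).
    rewrite ler_wpM2l ?invN_ge0 //; have := tau_gt0; have := h_gt0; move: (tau_le T) k1 k2.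
    set K := k%:R => tl k1 k2 hg tg.
    have : 0 <= (K - tau * h) * ((4 - tau) * h - K) by rewrite mulr_ge0 ?subr_ge0.
    nra.
  have -> : invN * (2 * tau * h * h) = 2 * tau * ((invN * h) * h) by ring.
  by rewrite invN_h -/q; lra.
have : 100 * L <= tau * q by rewrite /L mulrA ler_wpM2r ?(eta_tau T) // ltW ?q_gt0.
by have := starts_total_ge0 k; have := L_big T; lra.
Qed.

Definition excursion (s t : nat) :=
  [/\ (s < t)%N, (t <= m)%N, idl s, idl t & forall k, (s < k < t)%N -> ~~ idl k].

Lemma big_excursion s t : excursion s t -> s%:R < tau * h -> tau * h <= t%:R ->
  [/\ (4 - tau) * h <= t%:R, t%:R <= (4 + tau) * h &
      forall k, (k <= t)%N -> c k <= 6 * L].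
Proof.
move=> [st tm idls idlt busy] s_lt t_ge.
have t_big : (4 - tau) * h <= t%:R.
  rewrite leNgt; apply/negP => t_lt; have := no_idle tm; rewrite t_ge (ltW t_lt) idlt.
  by move/(_ isT).
have hg := h_gt0; have tg := tau_gt0.
have cb k : (k <= t)%N -> k%:R <= 6 * h -> c k <= 6 * L.
  move=> kt kh; apply: starts_bound => //; first exact: leq_trans tm.
  move=> j jk idj; have : (j <= s)%N.
    rewrite leqNgt; apply/negP => sj; have := busy j; rewrite sj (leq_trans jk) // idj.
    by move/(_ isT).
  rewrite -(ler_nat R) => js; move: (tau_le T); nra.
have t_small : t%:R <= (4 + tau) * h; last first.
  split=> // k kt; apply: cb => //; apply: (@le_trans _ _ t%:R); first by rewrite ler_nat.
  by move: (tau_le T); nra.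
rewrite leNgt; apply/negP => t_gt.
have th_big : 10000 <= tau * h.
  have : 100 * L <= tau * q by rewrite /L mulrA ler_wpM2r ?(eta_tau T) // ltW ?q_gt0.
  by have := q_le_h; have := L_big T; nra.
have ex : exists k, (4 + tau / 2) * h < k%:R :> R by exists t; move: t_gt tg hg; forget; nra.
case: (ex_minnP ex) => -[|k1] k1_gt k1_min; first by move: k1_gt hg tg; forget => /=; nra.
have k1_le : k1%:R <= (4 + tau / 2) * h.
  by rewrite leNgt; apply/negP => /k1_min; rewrite ltnn.
have k1_t : (k1 < t)%N by apply: k1_min; move: t_gt tg hg; forget; nra.
have k1h : k1.+1%:R <= 6 * h by rewrite -natr1; move: (tau_le T) k1_le th_big tg hg; forget; nra.
have := cb _ k1_t k1h; have := active_sum (leq_trans k1_t tm) k1h.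
have := a_ge0 T true k1.+1; have := a_ge0 T false k1.+1.
rewrite ler_norml => ag1 ag2 /andP[f1 f2] cle.
have : f k1.+1 <= - (tau * q / 2).
  have -> : f k1.+1 = - (invN * (k1.+1%:R * (k1.+1%:R - 4 * h)) / 4) by rewrite /f -invN_h; field.
  have : invN * (2 * tau * h * h) <= invN * (k1.+1%:R * (k1.+1%:R - 4 * h)).
    rewrite ler_wpM2l ?invN_ge0 //; move: k1_gt; set K := k1.+1%:R => kg.
    have : 0 <= (K - (4 + tau / 2) * h) * K by rewrite mulr_ge0 ?subr_ge0 ?ltW ?ler0n.
    have K4 : 0 <= K - 4 * h by move: kg (mulr_gt0 tg hg); forget; lra.
    have : 0 <= tau * h * (K - 4 * h) by rewrite mulr_ge0 // mulr_ge0 ?ltW.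
    by move: (mulr_gt0 tg hg) K4; forget; nra.
  have -> : invN * (2 * tau * h * h) = 2 * tau * ((invN * h) * h) by ring.
  by rewrite invN_h -/q; forget; lra.
have : 100 * L <= tau * q by rewrite /L mulrA ler_wpM2r ?(eta_tau T) // ltW ?q_gt0.
by have := L_big T; move: ag1 ag2 f1 f2 cle; forget; lra.
Qed.

(** * The regime of negative drift after the giant *)

Lemma discovered_upper r k : (k <= m)%N ->
  u (~~ r) k <= (1 + e) * x r k + 1 + noise r k + eta * h.
Proof.
elim: k => [|k IH] km.
  rewrite /noise big_ord0 /u !(x0 T) (a0 T) mulr0 !add0r addr0.
  by have := h_gt0; move: (eta_gt0 T); nra.
have := IH (ltnW km); have := noise_full T r (ltnW km); rewrite ler_norml => /andP[nz _].
have := u_turn T km; have := u_other T km; rewrite noiseS xSE // /indic.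
have := mulr_ge0 p_ge0 (discovered_ge0 (~~ r) (ltnW km)).
have := processed_ge0 r (ltnW km); have := idl_turn T (k := k); have := idl_a T (turn k) (k := k).
have := e_gt0 T.
case: (eqVneq (turn k) r) => [->|tr] eg ia it xg pu uo ut.
  by rewrite uo; have := p_mulN T; rewrite /=; lra.
have {tr} tE : turn k = ~~ r by move: tr; case: (turn k) (r) => -[].
rewrite tE negbK in ia it ut; rewrite ut /= mul0r !addr0.
(* At a start in class [~~ r], u (~~ r) = x (~~ r) <= x r by the choice of class, so the bound
   renews itself without counting starts. The term eta h makes up for a negative noise. *)
case: (idl k) ia it => /= [ia it|_ _]; last by rewrite addr0.
move=> _; rewrite {1}/u ia // addr0; have := it isT; have : 0 <= e * x r k by rewrite mulr_ge0 ?e_ge0.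
by move: nz; lra.
Qed.

(** Processed vertices are discovered, so [discovered_upper] bounds [x (~~ r)] by roughly [x r]; the
    two add up to [k]. *)
Lemma processed_late r k : (k <= m)%N -> 3 * h <= k%:R -> 48 / 100 * k%:R <= x r k.
Proof.
move=> km kh; have := discovered_upper r km; have := noise_full T r km; have := a_ge0 T (~~ r) k.
have : x r k + x (~~ r) k = k%:R by rewrite -(processed_sum km); case: (r); rewrite //= addrC.
have := processed_le r km; have := L_big T; have := L_le_q; have := q_le_h; have := e_le; have := e_gt0 T.
have : 100 * (eta * h) <= 10^-1 * h.
  by rewrite mulrA; exact: ler_wpM2r (ltW h_gt0) _ _ (le_trans (eta_tau T) (tau_le T)).
rewrite ler_norml /u; set X := x r k => etah eg es qh Lq Lb Xk xs ag /andP[_ nz] ul.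
have : e * X <= X / 5000 by move: es Xk xs ag nz; have := processed_ge0 r km; rewrite -/X; forget; nra.
move: etah eg es qh Lq Lb Xk xs ag nz ul kh; forget; lra.
Qed.

Lemma w_ge0 j : 0 <= w j.
Proof. by rewrite /w /damping; case: ifP => // _; rewrite divr_ge0 // mulr_ge0 // ltW ?h_gt0. Qed.

Lemma w_le1 j : w j <= 1.
Proof.
rewrite /w /damping; case: ifPn => //; rewrite -ltNge => jh.
by rewrite ler_pdivrMr ?mul1r ?ltW //; have := h_gt0; lra.
Qed.

Lemma w_anti j : w j.+1 <= w j.
Proof.
rewrite {2}/w {1}/damping; case: ifPn => [_|]; first exact: w_le1.
rewrite -ltNge => jh; have hg := h_gt0.
have j0 : 0 < j%:R :> R by lra.
have jj : j%:R <= j.+1%:R :> R by rewrite ler_nat.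
rewrite /w /damping ifN; last by rewrite -ltNge; lra.
by rewrite ler_wpM2l ?lef_pV2 ?posrE //; lra.
Qed.

(** The drift is at most e - 0.48 j / N <= -0.22 j / N, since j >= 3.9 h. Multiplied by the weight 1
    or 6 h / j, this is at most -0.7 e in either case. *)
Lemma drift j : (j <= m)%N -> (4 - tau) * h <= j%:R ->
  w j * (p * (N - u (~~ turn j) j) - 1) <= - (7 / 10 * e).
Proof.
move=> jm jh; have hg := h_gt0; have j3 : 39 / 10 * h <= j%:R.
  by apply: le_trans jh; rewrite ler_wpM2r ?(ltW hg) //; move: (tau_le T); lra.
have xl := @processed_late (~~ turn j) j jm; have {}xl := xl ltac:(lra).
have uge : 48 / 100 * j%:R <= u (~~ turn j) j.
  by rewrite /u; have := a_ge0 T (~~ turn j) j; lra.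
have ie : e <= invN * j%:R * (10 / 39).
  by rewrite -invN_h -mulrA ler_wpM2l ?invN_ge0 //; lra.
have iu : 48 / 100 * (invN * j%:R) <= invN * u (~~ turn j) j.
  by rewrite mulrCA ler_wpM2l ?invN_ge0.
have step : p * (N - u (~~ turn j) j) - 1 <= - (22 / 100 * (invN * j%:R)).
  rewrite mulrBr (p_mulN T) p_invN.
  have : 0 <= e * (invN * u (~~ turn j) j).
    by rewrite mulr_ge0 ?e_ge0 // mulr_ge0 ?invN_ge0 // discovered_ge0.
  have : 0 <= invN * j%:R by rewrite mulr_ge0 ?invN_ge0.
  lra.
apply: (@le_trans _ _ (w j * - (22 / 100 * (invN * j%:R)))).
  by rewrite ler_wpM2l ?w_ge0.
rewrite /w /damping; case: ifPn => [_|]; first by rewrite mul1r; have := e_gt0 T; lra.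
rewrite -ltNge => j6; have j0 : 0 < j%:R :> R by lra.
have -> : 6 * h / j%:R * - (22 / 100 * (invN * j%:R)) = - (132 / 100 * (invN * h)).
  by field; rewrite gt_eqF.
by rewrite invN_h; have := e_gt0 T; lra.
Qed.

Let W k := wnoise true k + wnoise false k.

Lemma wnoise_totalS k : W k.+1 = W k + w k * (hit k - p * (N - u (~~ turn k) k)).
Proof.
by rewrite /W /wnoise !big_ord_recr /= /indic; case: (turn k) => /=; ring.
Qed.

Lemma active_step k : (k < m)%N ->
  a true k.+1 + a false k.+1 = a true k + a false k + hit k - 1 + (idl k)%:R.
Proof.
move=> km; have := u_turn T km; have := u_other T km; rewrite /u !(xS T) //.
by case: (turn k) => /=; lra.
Qed.

(* Summation by parts: the weights decrease and the number of active vertices is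
   nonnegative, so the weighted sum of its increments is at least -1. *)
Lemma late_excursion s t : excursion s t -> (4 - tau) * h <= s%:R ->
  e * (t%:R - s%:R) <= 6 * L.
Proof.
move=> [st tm idls idlt busy] sh.
(* The -1 pays for the starting vertex, which is processed without a tree edge, at weight at most
   1. *)
have key k : (s + k.+1 <= t)%N ->
    w (s + k.+1) * (a true (s + k.+1) + a false (s + k.+1)) - 1 <=
    W (s + k.+1) - W s - 7 / 10 * e * k.+1%:R.
  elim: k => [|k IH] kt.
    rewrite addn1 in kt *; have sm : (s < m)%N := leq_trans kt tm.
    have := drift (ltnW sm) sh; have := active_step sm; have := w_le1 s.
    rewrite wnoise_totalS !(idl_a T _ idls) idls.
    have := ler_wpM2r (addr_ge0 (a_ge0 T true s.+1) (a_ge0 T false s.+1)) (w_anti s).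
    move=> h1 h2 h3; move: h1; rewrite h3 /=.
    by set pU := p * _; lra.
  rewrite addnS in kt *; have km : (s + k.+1 < m)%N := leq_trans kt tm.
  have kh : (4 - tau) * h <= (s + k.+1)%:R by apply: le_trans sh _; rewrite ler_nat leq_addr.
  have := drift (ltnW km) kh; have := active_step km; have := IH (ltnW kt).
  rewrite (negPf (busy _ _)) ?kt ?andbT ?addr0; last by rewrite -addn1 leq_add2l.
  rewrite wnoise_totalS -[k.+2%:R]natr1.
  have := ler_wpM2r (addr_ge0 (a_ge0 T true (s + k.+1).+1) (a_ge0 T false (s + k.+1).+1)) (w_anti (s + k.+1)).
  move=> h1 h2 h3; move: h1; rewrite h3 /=.
  by set pU := p * _; lra.
have := key (t - s).-1; rewrite prednK ?subn_gt0 // subnKC ?(ltnW st) // => /(_ (leqnn _)).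
(* Nothing is active at [t], and the noise difference is at most 4 L, so e (t - s) <= (4 L + 1) * 10
   / 7 <= 6 L. *)
rewrite !(idl_a T) // natrB ?(ltnW st) // /W.
have := wnoise_le T true tm; have := wnoise_le T false tm.
have := wnoise_le T true (leq_trans (ltnW st) tm); have := wnoise_le T false (leq_trans (ltnW st) tm).
rewrite !ler_norml => /andP[? ?] /andP[? ?] /andP[? ?] /andP[? ?].
have := L_big T; lra.
Qed.

Lemma giant_excursion s t : excursion s t -> 3 * h <= t%:R - s%:R ->
  s%:R < tau * h /\ tau * h <= t%:R.
Proof.
move=> exc sth; have [st tm idls idlt busy] := exc; have hg := h_gt0.
have sg : 0 <= s%:R :> R by [].
split; last by move: (tau_le T); nra.
rewrite ltNge; apply/negP => s_ge; have sm := leq_trans (ltnW st) tm.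
have s_late : (4 - tau) * h <= s%:R.
  rewrite leNgt; apply/negP => s_lt.
  by have := no_idle sm; rewrite s_ge (ltW s_lt) idls => /(_ isT).
have := late_excursion exc s_late; have := L_le_q; have := q_gt0.
have : e * (3 * h) <= e * (t%:R - s%:R) by rewrite ler_wpM2l ?e_ge0.
have -> : e * (3 * h) = 3 * q by rewrite /q; ring.
lra.
Qed.

Lemma excursion_around s t k : excursion s t -> (s <= k < t)%N -> h <= k%:R <= 2 * h ->
  3 * h <= t%:R - s%:R.
Proof.
move=> exc /andP[sk kt] /andP[k1 k2]; have [st tm idls idlt busy] := exc.
have hg := h_gt0; have tg := tau_gt0.
have s_le : s%:R <= k%:R :> R by rewrite ler_nat.
have t_ge : k%:R <= t%:R :> R by rewrite ler_nat ltnW.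
have s_lt : s%:R < tau * h.
  rewrite ltNge; apply/negP => s_ge.
  have := no_idle (leq_trans (ltnW st) tm); rewrite s_ge idls /=.
  by have -> : s%:R <= (4 - tau) * h by [move: (tau_le T); nra]; move/(_ isT).
have [|t_big _ _] := big_excursion exc s_lt; first by move: (tau_le T); nra.
by move: (tau_le T); nra.
Qed.

(** * Surplus edges of the giant excursion *)

Lemma surplus_step k : surplus k.+1 = surplus k + a (~~ turn k) k.
Proof. by rewrite /surplus big_ord_recr. Qed.

(** Antiderivative of the active count in [active_formula]; Phi (2 h) = (2/3) q h. *)
Let Phi z := e * z ^+ 2 / 2 - invN * z ^+ 3 / 6.

Lemma active_formula r k : (k <= m)%N -> k%:R <= 6 * h -> c k <= 6 * L ->
  `|a (~~ r) k - (e * x r k - invN * x r k ^+ 2 / 2)| <= 20 * L.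
Proof.
move=> km kh ck; have := discovered_formula r km kh; have := balance r km kh.
have := balance (~~ r) km kh; have := starts_le_c (~~ r) k; have := starts_ge0 (~~ r) k.
rewrite negbK /u /E /g; have := L_big T.
rewrite !ler_norml => Lb s1 s2 b1 b2 /andP[f1 f2].
by apply/andP; split; lra.
Qed.

(** Each round costs 20 L from [active_formula] and at most L for replacing the derivative of [Phi]
    by a unit difference. *)
Lemma surplus_formula k : (k <= m)%N -> k%:R <= 6 * h ->
  (forall j, (j <= k)%N -> c j <= 6 * L) ->
  `|surplus k - (Phi (x true k) + Phi (x false k))| <= 21 * L * k%:R.
Proof.
elim: k => [|k IH] km kh cL.
  rewrite /surplus big_ord0 !(x0 T) /Phi !expr0n /=.
  by have -> : 0 - (e * 0 / 2 - invN * 0 / 6 + (e * 0 / 2 - invN * 0 / 6)) = 0 :> R by [ring]; rewrite normr0 mulr0.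
have kh' : k%:R <= 6 * h by apply: le_trans kh; rewrite ler_nat.
have := IH (ltnW km) kh' (fun j jk => cL j (leqW jk)).
have := active_formula (turn k) (ltnW km) kh' (cL _ (leqnSn k)).
have := processed_ge0 (turn k) (ltnW km); have := processed_le (turn k) (ltnW km).
have iNk := invN_le kh; have := e_le; have := e_gt0 T; have := L_big T.
rewrite surplus_step -natr1 => Lb eg es xk xg.
have iX : 0 <= invN * x (turn k) k <= 6 * e.
  rewrite mulr_ge0 ?invN_ge0 //=; apply: le_trans iNk.
  by rewrite ler_wpM2l ?invN_ge0 // -natr1; lra.
have iN1 : 0 <= invN <= 6 * e.
  rewrite invN_ge0 /=; apply: le_trans iNk; rewrite ler_peMr ?invN_ge0 //.
  by rewrite ler1n.
have incr z : 0 <= invN * z <= 6 * e -> `|Phi (z + 1) - Phi z - (e * z - invN * z ^+ 2 / 2)| <= L.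
  have -> : Phi (z + 1) - Phi z - (e * z - invN * z ^+ 2 / 2) =
     e / 2 - (invN * z) / 2 - invN / 6 by rewrite /Phi; field.
  by move: iN1 Lb es; forget => /andP[? ?] ? ? /andP[? ?]; rewrite ler_norml; apply/andP; split; lra.
have := incr _ iX; rewrite !(xS T) // !ler_norml.
by case: (turn k) => /=; forget => /andP[? ?] /andP[? ?] /andP[? ?]; rewrite !addr0;
  apply/andP; split; lra.
Qed.

Lemma surplus_ge0 k : 0 <= surplus k.
Proof. by apply: sumr_ge0 => ? _; exact: a_ge0 T _ _. Qed.

(* The derivative [e z - z^2 / (2 N)] of [Phi] vanishes at [2 h]. *)
Lemma Phi_near z : `|z - 2 * h| <= tau * h -> `|Phi z - 2 / 3 * (q * h)| <= tau * (q * h) / 10.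
Proof.
set y := z - 2 * h => yle.
have -> : Phi z - 2 / 3 * (q * h) = - (e * y ^+ 2 / 2) - invN * y * y ^+ 2 / 6.
  by rewrite /Phi /y /q -invN_h; field.
have tg := tau_gt0; have hg := h_gt0; have eg := (e_gt0 T).
have y2 : y ^+ 2 <= tau ^+ 2 * h ^+ 2.
  rewrite -exprMn -(real_normK (num_real y)); have th0 : 0 <= tau * h := ltW (mulr_gt0 tg hg).
  by apply: lerXn2r; rewrite ?nnegrE ?normr_ge0.
have y2g := sqr_ge0 y.
have iy : `|invN * y| <= tau * e.
  rewrite normrM (ger0_norm invN_ge0) -invN_h mulrCA ler_wpM2l ?invN_ge0 //.
have ey : e * y ^+ 2 <= tau / 10 * (tau * (q * h)) * 10.
  have -> : tau / 10 * (tau * (q * h)) * 10 = e * (tau ^+ 2 * h ^+ 2) by rewrite /q; field.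
  by rewrite ler_wpM2l ?e_ge0.
have qhg : 0 < tau * (q * h) by rewrite mulr_gt0 // mulr_gt0 ?q_gt0.
have ey2 : e * y ^+ 2 <= tau * (q * h) / 10.
  by apply: le_trans ey _; move: (tau_le T); nra.
have eyg : 0 <= e * y ^+ 2 by rewrite mulr_ge0 ?e_ge0.
have iy2 : `|invN * y * y ^+ 2| <= e * y ^+ 2 / 10.
  rewrite normrM (ger0_norm y2g); apply: (@le_trans _ _ (tau * e * y ^+ 2)).
    by rewrite ler_wpM2r.
  by move: (tau_le T); nra.
by move: iy2; rewrite !ler_norml => /andP[? ?]; apply/andP; split; lra.
Qed.

Lemma giant_excess s t : excursion s t -> 3 * h <= t%:R - s%:R ->
  `|\sum_(s <= j < t) sur j - 1 - 4 / 3 * (e * q)| <= 3 * tau * (e * q).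
Proof.
move=> exc big; have [s_small t_ge] := giant_excursion exc big.
have [t_big t_small cL] := big_excursion exc s_small t_ge.
have [st tm _ _ _] := exc; have hg := h_gt0; have tg := tau_gt0; have qg := q_gt0.
have eg := (e_gt0 T); have sm := leq_trans (ltnW st) tm.
have th : t%:R <= 6 * h by move: (tau_le T); nra.
have sh : s%:R <= 6 * h by move: (tau_le T); nra.
have LT : 100 * L <= tau * q by rewrite /L mulrA ler_wpM2r ?(eta_tau T) // ltW ?q_gt0.
have qh := q_le_h.
have xt r : `|x r t - 2 * h| <= tau * h.
  have := balance r tm th; have := balance (~~ r) tm th; rewrite negbK.
  have := cL _ (leqnn t); have := L_big T.
  have : x r t + x (~~ r) t = t%:R by rewrite -(processed_sum tm); case: (r); rewrite //= addrC.
  have : tau * q <= tau * h by rewrite ler_wpM2l ?(ltW tg).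
  by rewrite ler_norml; move: LT t_big t_small; forget => *; apply/andP; split; lra.
have := surplus_formula tm th cL.
have := surplus_formula sm sh (fun j js => cL j (leq_trans js (ltnW st))).
have := Phi_near (xt true); have := Phi_near (xt false).
have qhg := mulr_gt0 qg hg; have tqhg := mulr_gt0 tg qhg.
have ttqh : tau * (tau * (q * h)) <= 10^-1 * (tau * (q * h)).
  by rewrite ler_wpM2r ?(tau_le T) // ltW.
(* The rounds before the giant starts contribute only at second order in tau h. *)
have Phi_s r : Phi (x r s) <= tau * (q * h) / 20.
  have xg := processed_ge0 r sm; have xs := processed_le r sm.
  have : 0 <= invN * x r s ^+ 3 by rewrite mulr_ge0 ?invN_ge0 ?exprn_ge0.
  have : e * x r s ^+ 2 <= e * (tau * h) ^+ 2.
    have xth : x r s <= tau * h by lra.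
    have th0 : 0 <= tau * h := ltW (mulr_gt0 tg hg).
    by rewrite ler_wpM2l ?e_ge0 //; apply: lerXn2r; rewrite ?nnegrE.
  have -> : e * (tau * h) ^+ 2 = tau * (tau * (q * h)) by rewrite /q; ring.
  by rewrite /Phi; move: ttqh tqhg; forget; lra.
have := Phi_s true; have := Phi_s false; have := surplus_ge0 s.
have LTt : 21 * L * t%:R <= tau * (q * h) * (9 / 10).
  apply: (@le_trans _ _ (21 * (tau * q / 100) * ((4 + tau) * h))).
    by apply: ler_pM => //; have := L_big T; move: LT t_small; forget; lra.
  by move: ttqh tqhg; forget; lra.
have LTs : 21 * L * s%:R <= tau * (q * h) / 10.
  apply: (@le_trans _ _ (21 * (tau * q / 100) * (tau * h))).
    by apply: ler_pM => //; have := L_big T; move: LT s_small; forget; lra.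
  by move: ttqh tqhg; forget; lra.
rewrite !ler_norml => S0 Ps1 Ps2 /andP[a1 a2] /andP[b1 b2] /andP[c1 c2] /andP[d1 d2].
have tqh : tau * (q * h) <= 10^-1 * (q * h) by rewrite ler_wpM2r ?(tau_le T) // ltW.
have St : `|surplus t - surplus s - 4 / 3 * (q * h)| <= 3 / 2 * tau * (q * h).
  rewrite ler_norml; move: S0 Ps1 Ps2 a1 a2 b1 b2 c1 c2 d1 d2 LTt LTs tqh qhg.
  by forget => *; apply/andP; split; lra.
(* Only now is the budget for the surplus noise known to suffice. *)
have St20 : surplus t <= 20 * (q * h).
  by move: a1 a2 b1 b2 d1 d2 LTt tqh qhg; forget; lra.
have Ss20 : surplus s <= 20 * (q * h).
  by move: c1 c2 Ps1 Ps2 LTs tqh qhg; forget; lra.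
have := surplus_noise_le T tm St20.
have := surplus_noise_le T sm Ss20.
have -> : \sum_(s <= j < t) sur j =
   surplus_noise t - surplus_noise s + p * (surplus t - surplus s).
  have split k : (k <= m)%N -> \sum_(0 <= j < k) sur j = surplus_noise k + p * surplus k.
    move=> _; rewrite /surplus_noise /surplus mulr_sumr -big_split /= big_mkord.
    by apply: eq_bigr => j _; ring.
  have H : \sum_(0 <= j < t) sur j = \sum_(0 <= j < s) sur j + \sum_(s <= j < t) sur j.
    by rewrite -big_cat_nat // ltnW.
  by move: H; rewrite (split _ tm) (split _ sm); forget; lra.
set Q := surplus t - surplus s in St *.
have pq : p * (q * h) = (1 + e) * (e * q) by rewrite p_invN -invN_h; ring.
have pSt : `|p * Q - 4 / 3 * ((1 + e) * (e * q))| <= 3 / 2 * tau * ((1 + e) * (e * q)).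
  rewrite -pq; have -> : p * Q - 4 / 3 * (p * (q * h)) = p * (Q - 4 / 3 * (q * h)) by ring.
  have -> : 3 / 2 * tau * (p * (q * h)) = p * (3 / 2 * tau * (q * h)) by ring.
  by rewrite normrM (ger0_norm p_ge0) ler_wpM2l ?p_ge0.
have eqg : 0 < e * q by rewrite mulr_gt0.
have eqg' := ltW eqg.
have e1 : e * (e * q) <= tau / 1000 * (e * q).
  by rewrite ler_wpM2r //; move: (e_eta T) (eta_tau T) (e_gt0 T); forget; lra.
have e2 : eta * (e * q) <= tau / 100 * (e * q).
  by rewrite ler_wpM2r //; move: (eta_tau T); forget; lra.
have e4 : 0 <= e * (e * q) by rewrite mulr_ge0 ?e_ge0.
have e3 : 0 <= tau * (e * (e * q)) <= tau / 1000 * (e * q).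
  rewrite mulr_ge0 ?(ltW tg) //=; apply: le_trans e1.
  by rewrite ler_piMl //; move: (tau_le T); forget; lra.
move: pSt; rewrite !ler_norml => /andP[p1 p2] /andP[n1 n2] /andP[n3 n4].
move: (cube_big T) e3 => big1 /andP[e30 e31]; move: p1 p2 n1 n2 n3 n4 e1 e2 e4 e30 e31 big1.
by forget => *; apply/andP; split; lra.
Qed.

End Trajectory.

(** * Probability bounds *)

Section Probability.
Variables (R : realFieldType) (n : nat) (p : R).
Implicit Types (st : xstate n) (G : bipgraph n) (q : 'I_n * 'I_n).

(** Weights may depend only on the state, so the number of processed vertices serves as the
    clock. *)
Definition tree_wt (r : bool) (v : nat -> R) st q : R :=
  ((turn st == r) && (q \in tree_pairs st))%:R *
  v (#|done st true| + #|done st false|)%N.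

Definition surplus_wt st q : R := (q \in surplus_pairs st)%:R.

Lemma sum_mem_hits (A B : {set 'I_n * 'I_n}) G (v : R) : A \subset B ->
  \sum_(q in B) (q \in A)%:R * v * ((q \in G)%:R - p) = v * (#|G :&: A|%:R - p * #|A|%:R).
Proof.
move=> AB; rewrite (big_setID A) /= (finset.setIidPr AB) [X in _ + X]big1 ?addr0; last first.
  by move=> q; rewrite inE => /andP[/negPf -> _]; rewrite !mul0r.
transitivity (\sum_(q in A) v * ((q \in G)%:R - p)).
  by apply: eq_bigr => q ->; rewrite mul1r.
rewrite -mulr_sumr sumrB sumr_const mulr_natr; congr (_ * (_ - _)).
rewrite -sumr_const (bigID (mem G)) /= [X in _ + X]big1 ?addr0; last first.
  by move=> q /andP[_ /negPf ->].
by apply: eq_big => [q|q /andP[_ ->]] //; rewrite inE andbC.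
Qed.

Lemma sum_mem_cost (A B : {set 'I_n * 'I_n}) (v : R) : A \subset B ->
  \sum_(q in B) ((q \in A)%:R * v) ^+ 2 = v ^+ 2 * #|A|%:R.
Proof.
move=> AB; rewrite (big_setID A) /= (finset.setIidPr AB) [X in _ + X]big1 ?addr0; last first.
  by move=> q; rewrite inE => /andP[/negPf -> _]; rewrite mul0r expr0n.
rewrite (eq_bigr (fun=> v ^+ 2)) => [|q ->]; last by rewrite mul1r.
by rewrite sumr_const mulr_natr.
Qed.

Section Graph.
Variable G : bipgraph n.
Let st k := run G k.

Definition ndone r k : R := #|done (st k) r|%:R.
Definition nactive r k : R := #|active (st k) r|%:R.
Definition xturn k := turn (st k).
Definition xidle k := idle (st k).
Definition xhit k : R := (tree_hits G k)%:R.
Definition xsur k : R := (surplus_hits G k)%:R.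

Lemma tree_increment r v k : (k < 2 * n)%N ->
  increment p (@revealed_pairs n) (tree_wt r v) (st k) G =
  (xturn k == r)%:R * (v k * (xhit k - p * (n%:R - (ndone (~~ r) k + nactive (~~ r) k)))).
Proof.
move=> kn; rewrite /increment /tree_wt card_done ?(ltnW kn) //.
rewrite /xturn; case: eqVneq => [tr|_] /=; last first.
  by rewrite [RHS]mul0r big1 // => q _; rewrite !mul0r.
rewrite sum_mem_hits ?finset.subsetUl // mul1r card_tree_pairs //.
rewrite -[in RHS]tr natrB; last by rewrite -[leqRHS]card_ord max_card.
by rewrite card_seen natrD.
Qed.

Lemma tree_cost r v k : (k < 2 * n)%N ->
  cost (@revealed_pairs n) (tree_wt r v) (st k) <= v k ^+ 2 * n%:R.
Proof.
move=> kn; rewrite /cost /tree_wt card_done ?(ltnW kn) //.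
case: eqVneq => [tr|_] /=; last first.
  rewrite big1 => [|q _]; last by rewrite mul0r expr0n.
  by rewrite mulr_ge0 // sqr_ge0.
rewrite sum_mem_cost ?finset.subsetUl // card_tree_pairs //.
by rewrite ler_wpM2l ?sqr_ge0 // ler_nat leq_subr.
Qed.

Lemma surplus_increment k : (k < 2 * n)%N ->
  increment p (@revealed_pairs n) surplus_wt (st k) G =
  xsur k - p * nactive (~~ xturn k) k.
Proof.
move=> kn; rewrite /increment /surplus_wt.
rewrite (eq_bigr (fun q => (q \in surplus_pairs (st k))%:R * 1 * ((q \in G)%:R - p))).
  by rewrite sum_mem_hits ?finset.subsetUr // mul1r card_surplus_pairs.
by move=> q _; rewrite mulr1.
Qed.

Lemma surplus_cost k : (k < 2 * n)%N ->
  cost (@revealed_pairs n) surplus_wt (st k) = nactive (~~ xturn k) k.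
Proof.
move=> kn; rewrite /cost /surplus_wt.
rewrite (eq_bigr (fun q => ((q \in surplus_pairs (st k))%:R * 1) ^+ 2)).
  by rewrite sum_mem_cost ?finset.subsetUr // expr1n mul1r card_surplus_pairs.
by move=> q _; rewrite mulr1.
Qed.

End Graph.

Definition exceeds_tree r v lam beta G : bool :=
  exceeds p (@revealed_pairs n) (@xstep n) (tree_wt r v) lam (2 * n) 0 beta (xstate0 n) G.

Definition exceeds_surplus lam beta G : bool :=
  exceeds p (@revealed_pairs n) (@xstep n) surplus_wt lam (2 * n) 0 beta (xstate0 n) G.

Lemma exceeds_treeN r v lam beta G k : ~~ exceeds_tree r v lam beta G ->
  \sum_(j < 2 * n) v j ^+ 2 * n%:R <= beta -> (k <= 2 * n)%N ->
  `|\sum_(j < k) (xturn G j == r)%:R *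
      (v j * (xhit G j - p * (n%:R - (ndone G (~~ r) j + nactive G (~~ r) j))))| <= lam.
Proof.
move=> NE cost_le kn; have := exceedsN NE kn; rewrite add0r.
under [X in `|X| <= _]eq_bigr => j _ do
  rewrite -tree_increment ?(leq_trans (ltn_ord j)) //.
move=> small; apply/ltW/small; apply: le_trans cost_le.
apply: (@le_trans _ _ (\sum_(j < k) v j ^+ 2 * n%:R)).
  by apply: ler_sum => j _; apply: tree_cost; rewrite (leq_trans (ltn_ord j)).
rewrite -!(big_mkord xpredT (fun j => v j ^+ 2 * n%:R)).
rewrite [leRHS](big_cat_nat (n := k)) //= lerDl.
by apply: sumr_ge0 => j _; rewrite mulr_ge0 ?sqr_ge0.
Qed.

Lemma exceeds_surplusN lam beta G k : ~~ exceeds_surplus lam beta G ->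
  (k <= 2 * n)%N -> surplus (nactive G) (xturn G) k <= beta ->
  `|surplus_noise p (nactive G) (xturn G) (xsur G) k| <= lam.
Proof.
move=> NE kn cost_le; have := exceedsN NE kn; rewrite add0r /surplus_noise.
under [X in `|X| <= _]eq_bigr => j _ do
  rewrite -surplus_increment ?(leq_trans (ltn_ord j)) //.
move=> small; apply/ltW/small; apply: le_trans cost_le; apply: ler_sum => j _.
by rewrite -surplus_cost ?(leq_trans (ltn_ord j)).
Qed.

Hypotheses (p_ge0 : 0 <= p) (p_le1 : p <= 1).

Lemma mean_exceeds_tree r v lam beta : 0 < lam -> 0 <= beta ->
  bern_mean p (fun G => (exceeds_tree r v lam beta G)%:R) <= p * beta / lam ^+ 2.
Proof.
move=> lam_gt0 beta_ge0; have -> : p * beta = 0 ^+ 2 + p * beta by rewrite expr0n add0r.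
exact: (adaptive_kolmogorov p_ge0 p_le1 _ (@xstep_local n) (@revealed_fresh n) (@used_xstep n)).
Qed.

Lemma mean_exceeds_surplus lam beta : 0 < lam -> 0 <= beta ->
  bern_mean p (fun G => (exceeds_surplus lam beta G)%:R) <= p * beta / lam ^+ 2.
Proof.
move=> lam_gt0 beta_ge0; have -> : p * beta = 0 ^+ 2 + p * beta by rewrite expr0n add0r.
exact: (adaptive_kolmogorov p_ge0 p_le1 _ (@xstep_local n) (@revealed_fresh n) (@used_xstep n)).
Qed.

End Probability.

Section Damping.
Variables (R : realFieldType) (h : R).
Hypothesis h_ge1 : 1 <= h.

(* [72 h^2 / k - 72 h^2 / (k + 1)] dominates the square [36 h^2 / k^2] of the weight. *)
Lemma sum_damping k : \sum_(j < k) damping h j ^+ 2 <= 20 * h.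
Proof.
have h1 := h_ge1; have h_gt0 : 0 < h by lra.
have low : forall k : nat, k%:R <= 6 * h -> \sum_(j < k) damping h j ^+ 2 = k%:R.
  move=> l lh; rewrite (eq_bigr (fun=> 1)); first by rewrite sumr_const card_ord.
  move=> j _; rewrite /damping ifT ?expr1n //; apply: le_trans lh.
  by rewrite ler_nat ltnW.
(* When 6 h is crossed, the sum is at most 6 h + 1 <= 7 h and 72 h^2 / k at most 12 h, whence 19
   h. *)
suff [kh|kh] : k%:R <= 6 * h \/
    (6 * h < k%:R /\ \sum_(j < k) damping h j ^+ 2 <= 19 * h - 72 * h ^+ 2 / k%:R).
- by rewrite low //; lra.
- case: kh => kh /le_trans; apply.
  have : 0 <= 72 * h ^+ 2 / k%:R by rewrite divr_ge0 // mulr_ge0 ?sqr_ge0.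
  lra.
elim: k => [|k IH]; first by left; rewrite /=; lra.
case: (lerP k.+1%:R (6 * h)) => kh; [by left | right; split => //].
rewrite big_ord_recr /=.
have kg : 0 < k.+1%:R :> R by [].
case: IH => [kh'|[kh' IH]].
  rewrite low // /damping kh' expr1n.
  have : 72 * h ^+ 2 / k.+1%:R <= 12 * h.
    by rewrite ler_pdivrMr //; nra.
  by set Z := _ / _; lra.
have k0 : 0 < k%:R :> R by lra.
rewrite {2}/damping [k%:R <= _]leNgt kh' /=.
have -> : (6 * h / k%:R) ^+ 2 = 36 * h ^+ 2 / k%:R ^+ 2 by field; rewrite gt_eqF.
suff key : 36 * h ^+ 2 / k%:R ^+ 2 <= 72 * h ^+ 2 / k%:R - 72 * h ^+ 2 / k.+1%:R.
  by have := lerD IH key; rewrite addrA subrK.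
have -> : 72 * h ^+ 2 / k%:R - 72 * h ^+ 2 / k.+1%:R = 72 * h ^+ 2 / (k%:R * (k%:R + 1)).
  by rewrite -natr1; field; rewrite !gt_eqF //= ?natr1.
rewrite -subr_ge0.
have -> : 72 * h ^+ 2 / (k%:R * (k%:R + 1)) - 36 * h ^+ 2 / k%:R ^+ 2 =
   36 * h ^+ 2 * (k%:R - 1) / (k%:R ^+ 2 * (k%:R + 1)).
  by field; rewrite !gt_eqF //= ?natr1.
have k1 : 0 <= k%:R - 1 :> R by lra.
apply: divr_ge0; first by apply: mulr_ge0 => //; rewrite mulr_ge0 ?sqr_ge0.
by apply: mulr_ge0; rewrite ?sqr_ge0 // addr_ge0.
Qed.

End Damping.

(** * Graphs that avoid the five bad events *)

Section GoodGraph.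
Variables (R : realFieldType) (n : nat) (e p eta tau : R) (G : bipgraph n).
Let N : R := n%:R.
Let h := e * N.
Let q := e * h.
Let L := eta * q.

Hypotheses (N_gt0 : 0 < N) (e_gt0 : 0 < e) (p_mulN : p * N = 1 + e).
Hypotheses (eta_gt0 : 0 < eta) (tau_le : tau <= 10^-1) (eta_tau : 100 * eta <= tau).
Hypothesis e_eta : 2000 * e <= eta.
Hypothesis L_big : 100 <= L.
Hypothesis eq_big : 1 <= eta * (e * q).
Hypothesis weighted_ok : forall r,
  ~~ exceeds_tree p r (damping h) L (20 * h * N) G.
Hypothesis full_ok : forall r,
  ~~ exceeds_tree p r (fun=> 1) (eta * h) (2 * N * N) G.
Hypothesis surplus_ok : ~~ exceeds_surplus p (eta * (e * q)) (20 * (q * h)) G.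

Let x := @ndone R n G.
Let a := @nactive R n G.

Let x0 r : x r 0 = 0.
Proof. by rewrite /x /ndone /run /= ffunE cards0. Qed.

Let a0 r : a r 0 = 0.
Proof. by rewrite /a /nactive /active /run /= !ffunE setD0 cards0. Qed.

Let a_ge0 r k : 0 <= a r k.
Proof. exact: ler0n. Qed.

Let xS r k : (k < 2 * n)%N -> x r k.+1 = x r k + (r == xturn G k)%:R.
Proof. by move=> kn; rewrite /x /ndone card_done_step // natrD. Qed.

Let seenE r k : x r k + a r k = #|seen (run G k) r|%:R.
Proof. by rewrite card_seen natrD. Qed.

Let u_turn k : (k < 2 * n)%N ->
  x (xturn G k) k.+1 + a (xturn G k) k.+1 =
  x (xturn G k) k + a (xturn G k) k + (xidle G k)%:R.
Proof. by move=> kn; rewrite !seenE card_seen_turn // natrD. Qed.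

Let u_other k : (k < 2 * n)%N ->
  x (~~ xturn G k) k.+1 + a (~~ xturn G k) k.+1 =
  x (~~ xturn G k) k + a (~~ xturn G k) k + xhit R G k.
Proof. by move=> kn; rewrite !seenE card_seen_other // natrD. Qed.

Let idl_a r k : xidle G k -> a r k = 0.
Proof. by rewrite /a /nactive => /andP[/eqP A1 /eqP A2]; case: r; rewrite ?A1 ?A2 cards0. Qed.

Let idl_turn k : xidle G k -> x (xturn G k) k <= x (~~ xturn G k) k.
Proof.
move=> id; rewrite ler_nat /xturn /turn -/(xidle G k) id.
by case: (leqP #|done _ true|) => le /=; [exact: le | exact: ltnW le].
Qed.

Let busy_turn k : ~~ xidle G k -> a (~~ xturn G k) k <= a (xturn G k) k.
Proof.
move=> id; rewrite ler_nat /xturn /turn -/(xidle G k) (negPf id).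
by case: (leqP #|active _ false|) => le /=; [exact: le | exact: ltnW le].
Qed.

Let h_ge1 : 1 <= h.
Proof.
have hg : 0 < h by rewrite /h mulr_gt0.
have qh : q <= h by rewrite /q ler_piMl ?ltW //; move: e_eta eta_tau tau_le; lra.
have : L <= q by rewrite /L ler_piMl //; [rewrite /q mulr_ge0 ?ltW | move: eta_tau tau_le; lra].
by move: L_big qh; lra.
Qed.

Let wnoise_le r k : (k <= 2 * n)%N ->
  `|wnoise N e p x a (xturn G) (xhit R G) r k| <= L.
Proof.
move=> kn; apply: exceeds_treeN (weighted_ok r) _ kn.
by rewrite -mulr_suml ler_wpM2r ?(ltW N_gt0) // sum_damping.
Qed.

Let noise_full r k : (k <= 2 * n)%N ->
  `|noise N p x a (xturn G) (xhit R G) r k| <= eta * h.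
Proof.
move=> kn; have := exceeds_treeN (full_ok r) _ kn; rewrite /noise.
under [X in `|X| <= _]eq_bigr => j _ do rewrite mul1r.
apply; rewrite sumr_const card_ord expr1n mul1r -[_ *+ (2 * n)]mulr_natl natrM; exact: lexx.
Qed.

Let surplus_noise_le k : (k <= 2 * n)%N ->
  surplus a (xturn G) k <= 20 * (q * h) ->
  `|surplus_noise p a (xturn G) (xsur R G) k| <= eta * (e * q).
Proof. by move=> kn; apply: exceeds_surplusN. Qed.

Let G_trajectory : trajectory (2 * n) N e p x a (xturn G) (xidle G) (xhit R G) (xsur R G)
  eta tau.
Proof. by split. Qed.

Lemma large_block s t : block G s t -> (t <= 2 * n)%N -> 3 * h <= t%:R - s%:R ->
  `|(excess (bip_adj G) (vset (run G t) :\: vset (run G s)))%:~R - 4 / 3 * (e * q)|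
    <= 3 * tau * (e * q).
Proof.
move=> b tn big; rewrite excess_block // intrD -!pmulrn natr_sum.
apply: (giant_excess G_trajectory _ big).
by case: b => *; split.
Qed.

(** The giant is the block around the first round not before [h]. *)
Lemma exists_large_block : exists (s t : nat),
  [/\ block G s t, (t <= 2 * n)%N & 3 * h <= t%:R - s%:R].
Proof.
have h1 := h_ge1; have e1 : e <= 1 by move: e_eta eta_tau tau_le; lra.
have hN : h <= N by rewrite /h ler_piMl // ltW.
have exk : exists k : nat, h <= k%:R by exists n.
case: (ex_minnP exk) => -[|k] hk k_min; first by move: hk; rewrite /=; lra.
have k_lt : k%:R < h by rewrite ltNge; apply/negP => /k_min; rewrite ltnn.
have kn : (k.+1 <= n)%N by apply: k_min.
have k2n : (k.+1 < 2 * n)%N.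
  by rewrite (leq_ltn_trans kn) // mul2n -addnn -[ltnLHS]addn0 ltn_add2l (leq_ltn_trans _ kn).
have [s [t [b tn st]]] := block_around G k2n; exists s, t; split=> //.
apply: (excursion_around G_trajectory _ st).
  by case: b => *; split.
by rewrite hk /= -natr1 -/h; lra.
Qed.

(** A largest component is at least as long as the block just found, and every block of length 3 h
    or more has the right excess; ties need no separate treatment. *)
Lemma largest_component_excess C : C \in largest_components (bip_adj G) ->
  `|(excess (bip_adj G) C)%:~R - 4 / 3 * (e * q)| <= 3 * tau * (e * q).
Proof.
rewrite inE => /andP[/component_block[s [t [b tn ->]]] /forallP largest].
apply: large_block => //.
have [s' [t' [b' tn' big]]] := exists_large_block.
have := largest (vset (run G t') :\: vset (run G s')).
rewrite block_component //= !card_block // -(ler_nat R).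
case: b b' => st _ _ _ [st' _ _ _]; rewrite !natrB ?(ltnW st) ?(ltnW st') //.
exact: le_trans big.
Qed.

End GoodGraph.

(** * Union bound over the bad events *)

Section ProbabilityBound.
Variables (R : realFieldType) (n : nat) (e eta tau : R).
Let N : R := n%:R.
Let p := (1 + e) / N.
Let h := e * N.
Let q := e * h.
Let L := eta * q.

Hypotheses (N_gt0 : 0 < N) (e_gt0 : 0 < e).
Hypotheses (eta_gt0 : 0 < eta) (tau_le : tau <= 10^-1) (eta_tau : 100 * eta <= tau).
Hypothesis e_eta : 2000 * e <= eta.
Hypothesis L_big : 100 <= L.
Hypothesis eq_big : 1 <= eta * (e * q).

Let bad_mass (G : bipgraph n) : R :=
  (exceeds_tree p true (damping h) L (20 * h * N) G)%:R +
  (exceeds_tree p false (damping h) L (20 * h * N) G)%:R +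
  (exceeds_tree p true (fun=> 1) (eta * h) (2 * N * N) G)%:R +
  (exceeds_tree p false (fun=> 1) (eta * h) (2 * N * N) G)%:R +
  (exceeds_surplus p (eta * (e * q)) (20 * (q * h)) G)%:R.

Lemma bern_meanD (T : finType) (f g : {set T} -> R) :
  bern_mean p (fun G => f G + g G) = bern_mean p f + bern_mean p g.
Proof. by rewrite -big_split; apply: eq_bigr => G _; rewrite mulrDr. Qed.

Lemma Gnnp_prob_ge (A : pred (bipgraph n)) :
  (forall G, (forall C, C \in largest_components (bip_adj G) ->
     `|(excess (bip_adj G) C)%:~R - 4 / 3 * (e * q)| <= 3 * tau * (e * q)) -> A G) ->
  1 - 200 / (eta ^+ 2 * (e * q)) <= Gnnp_prob p A.
Proof.
move=> goodA.
have eg := e_gt0; have hg : 0 < h by rewrite mulr_gt0.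
have qg : 0 < q by rewrite mulr_gt0.
have eqg : 0 < e * q by rewrite mulr_gt0.
have Lg : 0 < L by rewrite mulr_gt0.
have e1 : e <= 2000^-1 by move: e_eta eta_tau tau_le; lra.
have p_mulN : p * N = 1 + e by rewrite /p divfK // gt_eqF.
have p_ge0 : 0 <= p by rewrite divr_ge0 ?(ltW N_gt0) //; lra.
have p_le1 : p <= 1.
  rewrite ler_pdivrMr // mul1r.
  have : 1 <= e * (e * N).
    have : L <= q by rewrite /L ler_piMl ?(ltW qg) //; move: eta_tau tau_le; lra.
    by rewrite -/h -/q; move: L_big; lra.
  by have := N_gt0; nra.
have probE : Gnnp_prob p A = bern_mean p (fun G => (A G)%:R).
  rewrite /Gnnp_prob /bern_mean big_mkcond /=; apply: eq_bigr => G _.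
  by case: (A G); rewrite ?mulr1 ?mulr0.
have split G : 1 <= (A G)%:R + bad_mass G.
  case: (boolP (A G)) => [_|nA]; first by rewrite lerDl /bad_mass !addr_ge0.
  rewrite add0r /bad_mass.
  case: (boolP (exceeds_tree p true (damping h) L (20 * h * N) G)) => w1;
    first by rewrite -!addrA lerDl !addr_ge0.
  case: (boolP (exceeds_tree p false (damping h) L (20 * h * N) G)) => w2;
    first by rewrite add0r -!addrA lerDl !addr_ge0.
  case: (boolP (exceeds_tree p true (fun=> 1) (eta * h) (2 * N * N) G)) => w3;
    first by rewrite !add0r -!addrA lerDl !addr_ge0.
  case: (boolP (exceeds_tree p false (fun=> 1) (eta * h) (2 * N * N) G)) => w4;
    first by rewrite !add0r lerDl.
  case: (boolP (exceeds_surplus p (eta * (e * q)) (20 * (q * h)) G)) => w5;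
    first by rewrite !add0r.
  case/negP: nA; apply: goodA.
  by apply: (largest_component_excess N_gt0 e_gt0 p_mulN eta_gt0 tau_le eta_tau e_eta
    L_big eq_big _ _ w5); case.
have := bern_mean_le p_ge0 p_le1 split; rewrite bern_mean1 probE /bad_mass !bern_meanD.
have tree r v lam beta := @mean_exceeds_tree _ n _ p_ge0 p_le1 r v lam beta.
have b1 r := tree r (damping h) L (20 * h * N) Lg.
have b2 r := tree r (fun=> 1) (eta * h) (2 * N * N) (mulr_gt0 eta_gt0 hg).
have b3 := @mean_exceeds_surplus _ n _ p_ge0 p_le1 _ (20 * (q * h)) (mulr_gt0 eta_gt0 eqg).
set Z := (eta ^+ 2 * (e * q))^-1.
have Zg : 0 < Z by rewrite invr_gt0 mulr_gt0 ?exprn_gt0.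
(* With [p * N] = 1 + e, every failure bound is a multiple of [Z] = 1 / (eta^2 e^3 N), the
   unweighted ones with an extra factor e. *)
have z1 : p * (20 * h * N) / L ^+ 2 = 20 * (1 + e) * Z.
  have -> : p * (20 * h * N) = 20 * h * (p * N) by ring.
  by rewrite p_mulN /Z /L /q; field; rewrite !gt_eqF.
have z2 : p * (2 * N * N) / (eta * h) ^+ 2 = 2 * (1 + e) * (e * Z).
  have -> : p * (2 * N * N) = 2 * N * (p * N) by ring.
  by rewrite p_mulN /Z /L /q /h; field; rewrite !gt_eqF.
have z3 : p * (20 * (q * h)) / (eta * (e * q)) ^+ 2 = 20 * (1 + e) * Z.
  have -> : p * (20 * (q * h)) = 20 * (q * e) * (p * N) by rewrite /h; ring.
  by rewrite p_mulN /Z; field; rewrite !gt_eqF.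
have b1t := b1 true; have b1f := b1 false; have b2t := b2 true; have b2f := b2 false.
rewrite z1 in b1t b1f; rewrite z2 in b2t b2f; rewrite z3 in b3.
have c1 : 0 <= 20 * h * N by rewrite !mulr_ge0 // ltW.
have c2 : 0 <= 2 * N * N by rewrite !mulr_ge0 // ltW.
have c3 : 0 <= 20 * (q * h) by rewrite !mulr_ge0 // ltW.
move: (b1t c1) (b1f c1) (b2t c2) (b2f c2) (b3 c3).
have eZ : 0 <= e * Z <= Z by rewrite mulr_ge0 ?(ltW e_gt0) ?(ltW Zg) //= ler_piMl ?(ltW Zg) //; lra.
have e2Z : 0 <= e ^+ 2 * Z <= Z.
  rewrite mulr_ge0 ?sqr_ge0 ?(ltW Zg) //= ler_piMl ?(ltW Zg) //.
  by rewrite expr_le1 ?(ltW e_gt0) //; lra.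
move: eZ e2Z => /andP[? ?] /andP[? ?].
lra.
Qed.

End ProbabilityBound.

(** * Passage to the limit *)

Local Open Scope classical_set_scope.
Local Open Scope ring_scope.

Theorem theorem1p6 (R : realType) (eps : nat -> R)
  (eps_gt0 : forall n : nat, 0 < eps n)
  (eps3n_pinfty : eps n ^+ 3 * n%:R @[n --> \oo] --> +oo)
  (eps_to0 : eps n @[n --> \oo] --> (0 : R)) :
  forall delta : R, 0 < delta ->
    Gnnp_prob ((1 + eps n) / n%:R)
      (fun G : bipgraph n =>
         [forall C in largest_components (bip_adj G),
            `|(excess (bip_adj G) C)%:~R - 4 / 3 * eps n ^+ 3 * n%:R|
              <= delta * (4 / 3 * eps n ^+ 3 * n%:R)])
      @[n --> \oo] --> (1 : R).
Proof.
move=> delta delta_gt0; apply/cvgrPdist_le => /= err err_gt0.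
pose tau : R := Num.min (10^-1) (delta / 3); pose eta : R := tau / 100.
have tau_gt0 : 0 < tau by rewrite lt_min invr_gt0 ltr0n divr_gt0.
have tau_le : tau <= 10^-1 by rewrite ge_min lexx.
have tau_delta : tau <= delta / 3 by rewrite ge_min lexx orbT.
have eta_gt0 : 0 < eta by rewrite divr_gt0.
have eta_tau : 100 * eta <= tau by rewrite /eta; lra.
clearbody eta; clearbody tau.
have eta2_gt0 : 0 < eta / 2000 by move: eta_gt0; lra.
(* Once e^3 n exceeds [M], the first term gives the size conditions and the second keeps the failure
   probability below [err]. *)
pose M : R := 100 / eta + 200 / (eta ^+ 2 * err).
have M1 : 0 < 100 / eta by rewrite divr_gt0.
have M2 : 0 < 200 / (eta ^+ 2 * err) by rewrite divr_gt0 // mulr_gt0 ?exprn_gt0.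
near=> n.
have e_gt0 := eps_gt0 n.
have e_eta : 2000 * eps n <= eta.
  suff : `|0 - eps n| <= eta / 2000 by rewrite sub0r normrN ger0_norm ?(ltW e_gt0) //; lra.
  by near: n; move/cvgrPdist_le : eps_to0 => /(_ _ eta2_gt0).
have big : M <= eps n ^+ 3 * n%:R by near: n; move/cvgryPge : eps3n_pinfty => /(_ M).
have N_gt0 : 0 < n%:R :> R.
  rewrite ltr0n lt0n; apply: contraTneq big => ->.
  by rewrite mulr0 -ltNge /M addr_gt0.
set e := eps n in e_gt0 e_eta big *.
have cubeE : e ^+ 3 * n%:R = e * (e * (e * n%:R)) by ring.
rewrite cubeE in big.
have cube_gt0 : 0 < e * (e * (e * n%:R)) by rewrite !mulr_gt0.
have big1 : 100 <= eta * (e * (e * (e * n%:R))).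
  by rewrite mulrC -ler_pdivrMr //; apply: le_trans big; rewrite lerDl ltW.
have big2 : 200 / (eta ^+ 2 * (e * (e * (e * n%:R)))) <= err.
  have : 200 / (eta ^+ 2 * err) <= e * (e * (e * n%:R)) by apply: le_trans big; rewrite lerDr ltW.
  rewrite !ler_pdivrMr ?mulr_gt0 ?exprn_gt0 //.
  by rewrite [X in _ <= X -> _]mulrCA [_ * err]mulrC [X in _ -> _ <= X]mulrCA.
have L_big : 100 <= eta * (e * (e * n%:R)).
  apply: le_trans big1 _; rewrite ler_wpM2l ?(ltW eta_gt0) //.
  by rewrite ler_piMl ?mulr_ge0 ?(ltW e_gt0) //; lra.
set P := Gnnp_prob _ _.
have P_ge : 1 - 200 / (eta ^+ 2 * (e * (e * (e * n%:R)))) <= P.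
  apply: (@Gnnp_prob_ge R n e eta tau) => //; first by apply: le_trans big1; rewrite ler1n.
  move=> G goodG; apply/forall_inP => C /goodG.
  rewrite (_ : 4 / 3 * e ^+ 3 * n%:R = 4 / 3 * (e * (e * (e * n%:R)))); last by ring.
  move=> /le_trans; apply; move: cube_gt0; set X := e * _ => X_gt0.
  by rewrite [leRHS]mulrA ler_wpM2r ?(ltW X_gt0) //; move: tau_delta; lra.
have P_le : P <= 1.
  have e_le : e <= 2000^-1 by move: e_eta eta_tau tau_le; lra.
  have n_ge : 1 + e <= n%:R.
    have : 1 <= e * (e * n%:R).
      have : 1 <= eta * (e * (e * n%:R)) by apply: le_trans L_big; rewrite ler1n.
      have : eta * (e * (e * n%:R)) <= e * (e * n%:R).
        rewrite ler_piMl ?mulr_ge0 ?(ltW e_gt0) //; move: eta_tau tau_le; lra.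
      by move=> /[swap]; exact: le_trans.
    by move: e_gt0 e_le N_gt0; nra.
  have p_ge0 : 0 <= (1 + e) / n%:R by rewrite divr_ge0 ?addr_ge0 // ltW.
  have p_le1 : (1 + e) / n%:R <= 1 by rewrite ler_pdivrMr // mul1r.
  apply: (@le_trans _ _ (bern_mean ((1 + e) / n%:R) (fun=> 1))); last by rewrite bern_mean1.
  rewrite /P /Gnnp_prob big_mkcond /=; apply: ler_sum => G _; rewrite mulr1.
  case: ifP => // _.
  exact: bern_mass_ge0.
by rewrite ler_norml; apply/andP; split; move: P_ge P_le big2 err_gt0; lra.
Unshelve. all: by end_near.
Qed.
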